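(* Let $G$ be a Polish group. If the Polish group $L_0(G)$ has a comeager conjugacy class, then $G$ has a comeager conjugacy class.
   Context: A Polish group is a separable and completely metrizable topological group. Let $\mu$ be the Lebesgue measure on $[0,1]$. For a Polish group $G$, $L_0(G)$ is the group of all $\mu$-equivalence classes (equality $\mu$-almost everywhere) of $\mu$-measurable functions $[0,1]\to G$, with pointwise multiplication and the topology of convergence in measure: a basic neighbourhood of the identity is $\{f\in L_0(G)\colon \mu(\{x\in[0,1]\colon f(x)\notin V\})<\epsilon\}$, where $V$ is a neighbourhood of the identity in $G$ and $\epsilon>0$. $L_0(G)$ is a Polish group. A set is comeager if its complement is a countable union of nowhere dense sets. *)

(* Defs.v *)
From HB Require Import structures.
From mathcomp Require Import all_boot all_order all_algebra.
From mathcomp Require Import all_classical all_reals all_analysis.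

Set Implicit Arguments.
Unset Strict Implicit.
Unset Printing Implicit Defensive.

Import Order.TTheory GRing.Theory Num.Theory.

Local Open Scope classical_set_scope.
Local Open Scope ring_scope.

Section TopologicalNotions.
Context (R : realType) (T : topologicalType).

Definition separable : Prop := exists2 D : set T, countable D & dense D.

Definition is_metric (d : T -> T -> R) : Prop :=
  [/\ forall x, d x x = 0,
      forall x y, d x y = 0 -> x = y,
      forall x y, d x y = d y x &
      forall y x z, d x z <= d x y + d y z].

Definition metrizes (d : T -> T -> R) : Prop :=
  forall x, nbhs x = filter_from [set e : R | 0 < e]
                                 (fun e => [set y | d x y < e]).

Definition complete_metric (d : T -> T -> R) : Prop :=
  forall u : nat -> T,
    (forall e : R, 0 < e -> exists N, forall m n,
      (N <= m)%N -> (N <= n)%N -> d (u m) (u n) < e) ->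
    exists l : T, u @ \oo --> l.

Definition completely_metrizable : Prop :=
  exists d : T -> T -> R, [/\ is_metric d, metrizes d & complete_metric d].

Definition nowhere_dense (A : set T) : Prop := (closure A)° = set0.

Definition comeager (A : set T) : Prop :=
  exists2 F : nat -> set T, (forall n, nowhere_dense (F n)) &
                            ~` A = \bigcup_n F n.

End TopologicalNotions.
Arguments separable : clear implicits.
Arguments completely_metrizable : clear implicits.

HB.structure Definition PreTopologicalGroup :=
  {G of Topological G & Group G}.

HB.mixin Record PreTopologicalGroup_isTopologicalGroup G
    & PreTopologicalGroup G := {
  mulg_continuous : continuous (fun p : G * G => (p.1 * p.2)%g) ;
  invg_continuous : continuous (fun x : G => x^-1%g) ;
}.

#[short(type="topologicalGroupType")]
HB.structure Definition TopologicalGroup :=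
  {G of PreTopologicalGroup G & PreTopologicalGroup_isTopologicalGroup G}.

HB.mixin Record TopologicalGroup_isPolish (R : realType) G
    & TopologicalGroup G := {
  polish_separable : separable G ;
  polish_completely_metrizable : completely_metrizable R G ;
}.

#[short(type="polishGroupType")]
HB.structure Definition PolishGroup (R : realType) :=
  {G of TopologicalGroup G & TopologicalGroup_isPolish R G}.

Definition conjugacy_class (G : topologicalGroupType) (g : G) : set G :=
  [set (g ^ h)%g | h in [set: G]].

Definition has_comeager_conjugacy_class (G : topologicalGroupType) : Prop :=
  exists g : G, comeager (conjugacy_class g).

(* A copy of G carrying its Borel sigma-algebra; g_sigma_algebraType cannot be
   used directly because it requires a pointed type. *)
Definition borel (G : topologicalGroupType) : Type := G.

Section Borel.
Context (G : topologicalGroupType).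

HB.instance Definition _ := Choice.on (borel G).
HB.instance Definition _ := isPointed.Build (borel G) (1%g : G).

Let borelC (A : set (borel G)) : <<s @open G >> A -> <<s @open G >> (~` A).
Proof. by move=> mA; rewrite -setTD; exact: sigma_algebraCD. Qed.

HB.instance Definition _ := @isMeasurable.Build (sigma_display (@open G))
  (borel G) <<s @open G >> (@sigma_algebra0 _ setT _) borelC
  (@sigma_algebra_bigcup _ setT _).

Lemma open_borel (U : set G) : open U -> measurable (U : set (borel G)).
Proof. exact: sub_sigma_algebra. Qed.

Lemma borel_measurable d (T : measurableType d) (f : T -> borel G) :
  (forall U : set G, open U -> measurable (f @^-1` U)) ->
  measurable_fun [set: T] f.
Proof.
move=> mf; refine (@measurability _ _ T (borel G) setT f (@open G) _ _) => //.
by move=> _ [U oU <-]; rewrite setTI; exact: mf.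
Qed.

End Borel.

(* The probability space [0, 1]: a subset is measurable if it is Lebesgue
   measurable (i.e., Caratheodory measurable, not only Borel) in R. *)
Definition unit_interval (R : realType) : Type :=
  set_type (`[0, 1]%classic : set R).

Section UnitInterval.
Context (R : realType).
Local Notation I := (unit_interval R).
Local Notation leb := (@completed_lebesgue_measure R).
Local Notation LR := (caratheodory_type (wlength (R := R) idfun)^*%mu).

HB.instance Definition _ := Choice.on I.

Let zero01 : (0 : R) \in (`[0, 1]%classic : set R).
Proof. by rewrite inE /= in_itv /= lexx ler01. Qed.

HB.instance Definition _ := isPointed.Build I (exist _ 0 zero01).

Definition unit_interval_val (x : I) : LR := set_val x.
Local Notation v := unit_interval_val.

Let v_inj : injective v. Proof. exact: val_inj. Qed.

Let range_v : range v = `[0, 1]%classic.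
Proof.
apply/seteqP; split => [_ [x _ <-]|x x01].
  by rewrite /v set_valE; case: x => /= x /set_mem.
by exists (exist _ x (mem_set x01)).
Qed.

Let measurable01 : measurable (`[0, 1]%classic : set LR).
Proof.
by apply: sub_caratheodory; exact: measurable_itv.
Qed.

Definition unit_interval_measurable (A : set I) : Prop := measurable (v @` A).

Let uim0 : unit_interval_measurable set0.
Proof. by rewrite /unit_interval_measurable image_set0. Qed.

Let uimC A : unit_interval_measurable A -> unit_interval_measurable (~` A).
Proof.
move=> mA; rewrite /unit_interval_measurable.
suff -> : v @` (~` A) = `[0, 1]%classic `\` v @` A by exact: measurableD.
rewrite -range_v; apply/seteqP; split => [_ [x nAx <-]|_ [[x _ <-] nA]].
  by split; [exists x|move=> [y Ay /v_inj yx]; apply: nAx; rewrite -yx].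
by exists x => // Ax; apply: nA; exists x.
Qed.

Let uimU (F : (set I)^nat) : (forall i, unit_interval_measurable (F i)) ->
  unit_interval_measurable (\bigcup_i F i).
Proof.
by move=> mF; rewrite /unit_interval_measurable image_bigcup; exact: bigcupT_measurable.
Qed.

HB.instance Definition _ := @isMeasurable.Build default_measure_display I
  unit_interval_measurable uim0 uimC uimU.

Definition lebesgue01 (A : set I) : \bar R := leb (v @` A).

Let leb0 : lebesgue01 set0 = 0%E.
Proof. by rewrite /lebesgue01 image_set0 measure0. Qed.

Let leb_ge0 A : (0 <= lebesgue01 A)%E.
Proof. exact: measure_ge0. Qed.

Let leb_sigma : semi_sigma_additive lebesgue01.
Proof.
move=> F mF tF mUF; rewrite /lebesgue01 image_bigcup.
apply: (@measure_semi_sigma_additive _ _ _ leb (fun i => v @` F i)) => //.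
- move=> i j _ _ [_ [[x Fx <-] [y Fy /v_inj yx]]]; apply: tF => //.
  by exists x; split => //; rewrite -yx.
- by rewrite -image_bigcup.
Qed.

HB.instance Definition _ := isMeasure.Build _ _ _ lebesgue01
  leb0 leb_ge0 leb_sigma.

Let leb01 : lebesgue01 setT = 1%E.
Proof.
rewrite /lebesgue01 range_v.
have := @lebesgue_measure_itv R `[0, 1]; rewrite /= lte01 oppr0 adde0.
exact.
Qed.

HB.instance Definition _ := Measure_isProbability.Build _ _ _ lebesgue01 leb01.

End UnitInterval.
Arguments lebesgue01 : clear implicits.

Section PolishBase.
Context (R : realType) (G : polishGroupType R).

Lemma polish_second_countable : second_countable (T := G).
Proof.
have [D cD dD] := @polish_separable R G.
have [d [[dxx d0 dsym dtri] nbhsd _]] := @polish_completely_metrizable R G.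
have open_ball (x : G) e : open [set y | d x y < e].
  rewrite openE => y /= xy; rewrite /interior nbhsd.
  exists (e - d x y) => /=; first by rewrite subr_gt0.
  by move=> z /=; rewrite ltrBrDl; apply: le_lt_trans.
pose b (p : G * nat) := [set y | d p.1 y < p.2.+1%:R^-1].
exists (b @` (D `*` setT)).
  apply: sub_countable (card_image_le _ _) _.
  by apply: countableX => //; exact: countableP.
split=> [_ [p _ <-]|x A]; first exact: open_ball.
rewrite {1}nbhsd => -[e /= e0 eA].
have e20 : 0 < e / 2 by rewrite divr_gt0.
have [n _ /(_ n (leqnn _)) ne] := near_infty_natSinv_lt (PosNum e20).
have [|a [xa Da]] := dD _ _ (open_ball x n.+1%:R^-1).
  by exists x; rewrite /= dxx invr_gt0 ltr0Sn.
exists (b (a, n)); first by split; [exists (a, n)|rewrite /b /= dsym].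
move=> y /= ay; apply: eA => /=.
rewrite (le_lt_trans (dtri a _ _))// [e]splitr ltrD//.
  by apply: lt_trans xa _; exact: ne.
by apply: lt_trans ay _; exact: ne.
Qed.

Lemma measurable_pair_preimage d (T : measurableType d)
    (f g : T -> borel G) (W : set (G * G)) :
  measurable_fun [set: T] f -> measurable_fun [set: T] g ->
  open W -> measurable [set x | W (f x, g x)].
Proof.
move=> mf mg oW; have [B cB [oB bB]] := polish_second_countable.
pose C := [set p : set G * set G | (B `*` B) p /\ p.1 `*` p.2 `<=` W].
have cC : countable C.
  by apply: sub_countable (countableX cB cB); apply: subset_card_le => p [].
rewrite (_ : [set x | _] =
    \bigcup_(p in C) (f @^-1` p.1 `&` g @^-1` p.2)); last first.
  apply/seteqP; split=> [x /= Wx|x [[U V] [_ UVW] /= [Ux Vx]]]; last first.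
    exact: (UVW (f x, g x)).
  have : nbhs ((f x, g x) : G * G) W by move: oW; rewrite openE; apply.
  case=> -[P Q] /= [/bB[U /= [BU Ux UP]] /bB[V /= [BV Vx VQ]]] PQW.
  exists (U, V) => //; split=> // -[y z] /= [Uy Vz].
  by apply: PQW; split; [exact: UP|exact: VQ].
rewrite bigcup_set_type; apply: countable_bigcupT_measurable.
  by rewrite (eq_countable (card_setT C)).
move=> [p /= /set_mem[[BU BV] _]].
apply: measurableI; rewrite -[X in measurable X]setTI.
  by apply: mf => //; exact: (open_borel (oB _ BU)).
by apply: mg => //; exact: (open_borel (oB _ BV)).
Qed.

End PolishBase.

Section L0.
Context d (T : measurableType d) (R : realType) (mu : probability T R).
Context (G : polishGroupType R).
Local Notation mfunG := {mfun T >-> borel G}.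

Definition mfun1 : T -> borel G := fun=> (1%g : G).
Definition mfunM (f g : T -> borel G) : T -> borel G :=
  fun x => ((f x : G) * (g x : G))%g.
Definition mfunV (f : T -> borel G) : T -> borel G := fun x => ((f x : G)^-1)%g.

Let mfun1_subproof : measurable_fun setT mfun1.
Proof. exact: measurable_cst. Qed.

Let mfunM_subproof (f g : mfunG) : measurable_fun setT (mfunM f g).
Proof.
apply: borel_measurable => U oU.
apply: (@measurable_pair_preimage _ _ _ _ f g
  ((fun p : G * G => (p.1 * p.2)%g) @^-1` U)) => //.
by have /continuousP := @mulg_continuous G; apply.
Qed.

Let mfunV_subproof (f : mfunG) : measurable_fun setT (mfunV f).
Proof.
apply: borel_measurable => U oU.
have oV : open ((fun x : G => x^-1%g) @^-1` U).
  by have /continuousP := @invg_continuous G; apply.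
rewrite -[X in measurable X]setTI.
exact: (@measurable_funPT _ _ _ _ f _ _ (open_borel oV)).
Qed.

HB.instance Definition _ := isMeasurableFun.Build _ _ _ _ mfun1 mfun1_subproof.
HB.instance Definition _ (f g : mfunG) :=
  isMeasurableFun.Build _ _ _ _ (mfunM f g) (mfunM_subproof f g).
HB.instance Definition _ (f : mfunG) :=
  isMeasurableFun.Build _ _ _ _ (mfunV f) (mfunV_subproof f).

(* Almost-everywhere classes of measurable functions T -> G; an element is
   applied to a point through a representative. *)
Definition L0 : Type := {mfun_ mu, T >-> borel G}.
HB.instance Definition _ := Choice.on L0.

Definition L0_fun (f : L0) : T -> G := aqEqMfun_to_fun f.
Coercion L0_fun : L0 >-> Funclass.

Definition L0_pi (f : mfunG) : L0 := (\pi_{mfun_ mu, T >-> borel G} f)%qT.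

Definition L0_one : L0 := L0_pi mfun1.
Definition L0_mul (f g : L0) : L0 := L0_pi (mfunM (repr f) (repr g)).
Definition L0_inv (f : L0) : L0 := L0_pi (mfunV (repr f)).

Lemma L0_piE (f : mfunG) : \forall x \ae mu, L0_pi f x = f x.
Proof.
have : (repr (L0_pi f) = f %[mod {mfun_ mu, T >-> borel G}])%qT.
  by rewrite reprK.
by move=> /eqmodP/asboolP; apply: filterS => x /(_ I).
Qed.

Lemma L0_eq (f g : L0) : (\forall x \ae mu, f x = g x) -> f = g.
Proof.
move=> fg; rewrite -[f]reprK -[g]reprK; apply/eqmodP/asboolP.
by apply: filterS fg.
Qed.

Lemma L0_oneE : \forall x \ae mu, L0_one x = 1%g.
Proof. exact: L0_piE. Qed.

Lemma L0_mulE (f g : L0) : \forall x \ae mu, L0_mul f g x = (f x * g x)%g.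
Proof. exact: L0_piE. Qed.

Lemma L0_invE (f : L0) : \forall x \ae mu, L0_inv f x = (f x)^-1%g.
Proof. exact: L0_piE. Qed.

Let L0_mulA : associative L0_mul.
Proof.
move=> f g h; apply: L0_eq; near=> x.
rewrite (near (L0_mulE f (L0_mul g h)) x)// (near (L0_mulE g h) x)//.
rewrite (near (L0_mulE (L0_mul f g) h) x)// (near (L0_mulE f g) x)//.
by rewrite mulgA.
Unshelve. all: by end_near. Qed.

Let L0_mul1g : left_id L0_one L0_mul.
Proof.
move=> f; apply: L0_eq; near=> x.
by rewrite (near (L0_mulE L0_one f) x)// (near L0_oneE x)// mul1g.
Unshelve. all: by end_near. Qed.

Let L0_mulg1 : right_id L0_one L0_mul.
Proof.
move=> f; apply: L0_eq; near=> x.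
by rewrite (near (L0_mulE f L0_one) x)// (near L0_oneE x)// mulg1.
Unshelve. all: by end_near. Qed.

Let L0_mulVg : left_inverse L0_one L0_inv L0_mul.
Proof.
move=> f; apply: L0_eq; near=> x.
rewrite (near (L0_mulE (L0_inv f) f) x)// (near L0_oneE x)//.
by rewrite (near (L0_invE f) x)// mulVg.
Unshelve. all: by end_near. Qed.

Let L0_mulgV : right_inverse L0_one L0_inv L0_mul.
Proof.
move=> f; apply: L0_eq; near=> x.
rewrite (near (L0_mulE f (L0_inv f)) x)// (near L0_oneE x)//.
by rewrite (near (L0_invE f) x)// mulgV.
Unshelve. all: by end_near. Qed.

HB.instance Definition _ := isGroup.Build L0
  L0_mulA L0_mul1g L0_mulg1 L0_mulVg L0_mulgV.

Lemma L0_1E : \forall x \ae mu, (1%g : L0) x = 1%g.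
Proof. exact: L0_oneE. Qed.

Lemma L0_ME (f g : L0) : \forall x \ae mu, ((f * g)%g : L0) x = (f x * g x)%g.
Proof. exact: L0_mulE. Qed.

Lemma L0_VE (f : L0) : \forall x \ae mu, ((f^-1)%g : L0) x = (f x)^-1%g.
Proof. exact: L0_invE. Qed.

Lemma L0_JE (f g : L0) : \forall x \ae mu, ((f ^ g)%g : L0) x = (f x ^ g x)%g.
Proof.
near=> x; rewrite !conjgE (near (L0_ME g^-1%g (f * g)%g) x)//.
by rewrite (near (L0_VE g) x)// (near (L0_ME f g) x).
Unshelve. all: by end_near. Qed.

Lemma L0_measurable (f : L0) (U : set G) : open U -> measurable (f @^-1` U).
Proof.
move=> oU; rewrite -[X in measurable X]setTI.
exact: (@measurable_funPT _ _ _ _ (repr f) _ _ (open_borel oU)).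
Qed.

Lemma ae_le_measure (A B : set T) : measurable A -> measurable B ->
  (\forall x \ae mu, A x -> B x) -> (mu A <= mu B)%E.
Proof.
move=> mA mB [N [mN N0 AN]]; rewrite -(measureU0 mB mN N0).
apply: le_measure; rewrite ?inE//; first exact: measurableU.
move=> x Ax; have [Bx|nBx] := pselect (B x); first by left.
by right; apply: AN => /= /(_ Ax).
Qed.

(* Basic neighbourhoods of the identity for convergence in measure, used below
   with V open: the set is then measurable, and the open neighbourhoods form a
   base of all neighbourhoods. *)
Definition L0_ball (V : set G) (e : R) : set L0 :=
  [set f | (mu [set x | ~ V (f x)] < e%:E)%E].

(* The basic neighbourhoods of f are the left translates by f of those of the
   identity. *)
Definition L0_nbhs (f : L0) : set_system L0 :=
  filter_from [set Ve : set G * R | open_nbhs 1%g Ve.1 /\ 0 < Ve.2]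
              (fun Ve => [set (f * h)%g | h in L0_ball Ve.1 Ve.2]).

Lemma L0_nbhsP (f : L0) (A : set L0) : L0_nbhs f A <->
  exists V e, [/\ open_nbhs 1%g V, 0 < e &
                  forall h, L0_ball V e h -> A (f * h)%g].
Proof.
split=> [[[V e] /= [oV e0] VA]|[V [e [oV e0 VA]]]].
  by exists V, e; split=> // h Vh; apply: VA; exists h.
by exists (V, e) => // _ /= [h Vh <-]; exact: VA.
Qed.

Let measurable_notin (f : L0) (V : set G) :
  open V -> measurable [set x | ~ V (f x)].
Proof. by move=> oV; apply/measurableC/L0_measurable. Qed.

Lemma L0_ball1 (V : set G) e : open_nbhs 1%g V -> 0 < e -> L0_ball V e 1%g.
Proof.
move=> [oV V1] e0; rewrite /L0_ball /=.
apply: (@le_lt_trans _ _ (mu set0)); last by rewrite measure0 lte_fin.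
apply: ae_le_measure => //; first exact: measurable_notin.
by apply: filterS L0_1E => x x1 nV; apply: nV; move: V1; rewrite -x1.
Qed.

Lemma L0_ballS (V W : set G) e e' : open V -> open W ->
  V `<=` W -> e <= e' -> L0_ball V e `<=` L0_ball W e'.
Proof.
move=> oV oW VW ee f; rewrite /L0_ball /= => fV.
apply: (@lt_le_trans _ _ e%:E); last by rewrite lee_fin.
apply: le_lt_trans fV.
apply: le_measure; rewrite ?inE; [exact: measurable_notin..|].
by move=> x /= nW /VW.
Qed.

Lemma L0_ball_or (U V W : set G) e e' (f g h : L0) :
  open U -> open V -> open W ->
  (\forall x \ae mu, U (f x) -> V (g x) -> W (h x)) ->
  L0_ball U e f -> L0_ball V e' g -> L0_ball W (e + e') h.
Proof.
move=> oU oV oW UVW fU gV; rewrite /L0_ball /=.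
pose A := [set x | ~ U (f x)]; pose B := [set x | ~ V (g x)].
have mA : measurable A by exact: measurable_notin.
have mB : measurable B by exact: measurable_notin.
apply: (@le_lt_trans _ _ (mu (A `|` B))).
  apply: ae_le_measure; [exact: measurable_notin|exact: measurableU|].
  apply: filterS UVW => x UVW nW; apply: contrapT => /not_orP[/contrapT Ux].
  by move=> /contrapT Vx; apply: nW; exact: UVW.
by apply: (le_lt_trans (measureU2 _ mA mB)); rewrite EFinD lteD.
Qed.

Lemma mulg_open_nbhs (V : set G) : open_nbhs 1%g V ->
  exists2 W, open_nbhs 1%g W & forall x y, W x -> W y -> V (x * y)%g.
Proof.
move=> [oV V1]; have := @mulg_continuous G (1%g, 1%g) V.
rewrite /= mulg1 => /(_ (open_nbhs_nbhs (conj oV V1))).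
case=> -[P Q] /= [nP nQ] PQ.
have : nbhs (1%g : G) (P `&` Q) by exact: filterI.
rewrite nbhsE => -[W oW WPQ].
by exists W => // x y /WPQ[Px _] /WPQ[_ Qy]; exact: (PQ (x, y)).
Qed.

Lemma invg_open_nbhs (V : set G) : open_nbhs 1%g V ->
  exists2 W, open_nbhs 1%g W & forall x, W x -> V (x^-1)%g.
Proof.
move=> [oV V1]; have := @invg_continuous G 1%g V.
rewrite invg1 => /(_ (open_nbhs_nbhs (conj oV V1))).
rewrite /nbhs /= -/(nbhs _ _) nbhsE => -[W oW WV].
by exists W => // x /WV.
Qed.

Lemma conjg_continuous : continuous (fun p : G * G => (p.1 ^ p.2)%g).
Proof.
move=> p.
have -> : (fun p : G * G => (p.1 ^ p.2)%g) =
  (fun p : G * G => (p.2^-1 * (p.1 * p.2))%g).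
  by apply/funext => q; rewrite conjgE.
apply: (@cvg_comp _ _ _ (fun q : G * G => ((q.2^-1)%g, (q.1 * q.2)%g))
  (fun q : G * G => (q.1 * q.2)%g)); last first.
  exact: (@mulg_continuous G ((p.2^-1)%g, (p.1 * p.2)%g)).
apply: cvg_pair; last exact: mulg_continuous.
apply: (@cvg_comp _ _ _ snd (fun x : G => x^-1%g)); first exact: cvg_snd.
exact: invg_continuous.
Qed.

Lemma L0_conj_ball (g : L0) (V : set G) (e : R) : open_nbhs 1%g V -> 0 < e ->
  exists W e', [/\ open_nbhs 1%g W, 0 < e' &
                   forall h, L0_ball W e' h -> L0_ball V e (h ^ g)%g].
Proof.
move=> [oV V1] e0.
have [dist [[d0 _ _ dtri] nbhsd _]] := @polish_completely_metrizable R G.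
pose W n := [set y : G | dist 1%g y < n.+1%:R^-1].
have oW n : open_nbhs 1%g (W n).
  split; last by rewrite /W /= d0 invr_gt0 ltr0Sn.
  rewrite openE => y /= xy; rewrite /interior nbhsd.
  exists (n.+1%:R^-1 - dist 1%g y) => /=; first by rewrite subr_gt0.
  by move=> z /=; rewrite ltrBrDl; apply: le_lt_trans.
pose B n := interior [set y : G | forall h, W n h -> V (h ^ y)%g].
have BT y : exists n, B n y.
  have := @conjg_continuous (1%g, y) V.
  rewrite /= conj1g => /(_ (open_nbhs_nbhs (conj oV V1))).
  case=> -[P Q] /= [nP nQ] PQ; move: nP; rewrite nbhsd => -[r /= r0 rP].
  have [n _ /(_ n (leqnn _)) nr] := near_infty_natSinv_lt (PosNum r0).
  exists n; rewrite /B; apply: filterS nQ => z Qz h Wh.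
  by apply: (PQ (h, z)); split=> //; apply: rP; exact: lt_trans Wh _.
have oB n : open (B n) by exact: open_interior.
have BS m n : (m <= n)%N -> B m `<=` B n.
  move=> mn; rewrite /B; apply: interiorS => y mV h Wh; apply: mV.
  by apply: lt_le_trans Wh _; rewrite lef_pV2 ?posrE// ler_nat.
pose F n := [set x | ~ B n (g x)].
have mF n : measurable (F n) by exact: measurable_notin.
have F0 : \bigcap_n F n = set0.
  apply/seteqP; split=> // x Fx; have [n Bn] := BT (g x).
  exact: (Fx n I Bn).
have : mu \o F @ \oo --> mu (\bigcap_n F n).
  apply: nonincreasing_cvg_mu => //.
  - by rewrite (le_lt_trans (probability_le1 mu (mF 0%N)))// ltry.
  - by rewrite F0.
  - by move=> m n mn; apply/subsetPset => x nB /(BS _ _ mn).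
rewrite F0 measure0 => /fine_cvgP[_ /cvgrPdist_lt].
have e20 : 0 < e / 2 by rewrite divr_gt0.
move=> /(_ _ e20)[n _ /(_ n (leqnn _))] /=.
rewrite sub0r normrN ger0_norm ?fine_ge0// => Fn.
exists (W n), (e / 2); split=> // h Wh; rewrite [e]splitr.
apply: (L0_ball_or _ _ _ _ Wh (_ : L0_ball (B n) (e / 2) g)) => //.
- by have [] := oW n.
- apply: filterS (L0_JE h g) => x -> Wx.
  by move=> /interior_subset; apply.
- rewrite /L0_ball /= -[X in (X < _)%E]fineK ?lte_fin//.
  exact: (fin_num_measure mu _ (mF n)).
Qed.

HB.instance Definition _ := hasNbhs.Build L0 L0_nbhs.

Let L0_nbhs_singleton (f : L0) (A : set L0) : nbhs f A -> A f.
Proof.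
by move=> /L0_nbhsP[V [e [oV e0 VA]]]; rewrite -[f]mulg1; exact/VA/L0_ball1.
Qed.

Let L0_nbhs_filter (f : L0) : ProperFilter (nbhs f).
Proof.
apply: filter_from_proper; last first.
  by move=> [V e] /= [oV e0]; exists (f * 1)%g, 1%g => //; exact: L0_ball1.
apply: filter_from_filter.
  by exists (setT, 1); split=> //=; exact: open_nbhsT.
move=> [V e] [W e'] /= [oV e0] [oW e0'].
have oVW := open_nbhsI oV oW.
exists (V `&` W, Num.min e e'); first by rewrite /= lt_min e0 e0'.
move=> _ [h hVW <-] /=; move: oV oW oVW => [oV _] [oW _] [oVW _].
by split; exists h => //; apply: L0_ballS hVW => //;
  [exact: subIsetl|rewrite ge_min lexx|exact: subIsetr|
   rewrite ge_min lexx orbT].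
Qed.

Lemma L0_ballM (V W : set G) e e' (h k : L0) : open V -> open W ->
  (forall x y, W x -> W y -> V (x * y)%g) ->
  L0_ball W e h -> L0_ball W e' k -> L0_ball V (e + e') (h * k)%g.
Proof.
move=> oV oW WV; apply: L0_ball_or => //.
by apply: filterS (L0_ME h k) => x -> ? ?; exact: WV.
Qed.

Let L0_nbhs_nbhs (f : L0) (A : set L0) : nbhs f A -> nbhs f (nbhs^~ A).
Proof.
move=> /L0_nbhsP[V [e [oV e0 VA]]]; have [W oW WV] := mulg_open_nbhs oV.
have e20 : 0 < e / 2 by rewrite divr_gt0.
apply/L0_nbhsP; exists W, (e / 2); split=> // h Wh.
apply/L0_nbhsP; exists W, (e / 2); split=> // k Wk.
rewrite -mulgA; apply: VA; rewrite [e]splitr.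
by apply: L0_ballM Wh Wk => //; [case: oV|case: oW].
Qed.

HB.instance Definition _ := Nbhs_isNbhsTopological.Build L0
  L0_nbhs_filter L0_nbhs_singleton L0_nbhs_nbhs.

Let L0_mul_continuous : continuous (fun p : L0 * L0 => (p.1 * p.2)%g).
Proof.
move=> [f g] A /= /L0_nbhsP[V [e [oV e0 VA]]].
have [W oW WV] := mulg_open_nbhs oV.
have e20 : 0 < e / 2 by rewrite divr_gt0.
have [U [r [oU r0 UW]]] := L0_conj_ball g oW e20.
exists ([set (f * h)%g | h in L0_ball U r],
        [set (g * k)%g | k in L0_ball W (e / 2)]).
  by split; apply/L0_nbhsP; [exists U, r|exists W, (e / 2)]; split=> // h Bh;
    exists h.
move=> _ [/= [h Uh <-] [k Wk <-]].
have E : ((f * h) * (g * k) = (f * g) * (h ^ g * k))%g.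
  by rewrite mulgA -(mulgA f h) (conjgC h) !mulgA.
rewrite /= E; apply: VA; rewrite [e]splitr.
by apply: L0_ballM (UW _ Uh) Wk => //; [case: oV|case: oW].
Qed.

Let L0_inv_continuous : continuous (fun f : L0 => f^-1%g).
Proof.
move=> f A /L0_nbhsP[V [e [oV e0 VA]]].
have [W [r [oW r0 WV]]] := L0_conj_ball (f^-1)%g oV e0.
have [U oU UW] := invg_open_nbhs oW.
apply/L0_nbhsP; exists U, r; split=> // h Uh /=.
rewrite invgM conjgC; apply/VA/WV; rewrite /L0_ball /=; apply: le_lt_trans Uh.
apply: ae_le_measure; [by apply: measurable_notin; case: oW
                      |by apply: measurable_notin; case: oU|].
by apply: filterS (L0_VE h) => x hx nW /UW; rewrite -hx.
Qed.

HB.instance Definition _ := PreTopologicalGroup_isTopologicalGroup.Build L0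
  L0_mul_continuous L0_inv_continuous.

End L0.

Arguments L0 {d T R} mu G.

(* Main.v *)
Require Import Defs.
From mathcomp Require Import all_boot all_order all_algebra.
From mathcomp Require Import all_classical all_reals all_analysis.
From mathcomp Require Import lra zify measurable_realfun.

(** Conjugation is a continuous action of the Polish group G on itself, and two
    first-category conditions on it produce a comeager orbit:
    - conj_transitive: some conjugate of some point of U lies in W, for any
      nonempty open U and W;
    - conj_locally_transitive: given a neighbourhood V of 1, every nonempty
      open set contains a nonempty open W any two open parts of which are
      still connected when the conjugators are restricted to V.
    Indeed the first makes the generic orbit dense; the second makes the
    generic point x interior to the closure of its V-orbit, for all V at once.
    Two points with both properties are conjugate: a back-and-forth
    construction moves them alternately towards each other by conjugators so
    small that their products converge (comeager_conjugacy_class_criterion).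

    Both conditions descend from L0(G) to G when some class, that of f, is
    comeager in L0(G). As L0(G) is a Baire space (L0_baire), the class of f is
    dense, so f has a conjugate with values in U off a set of measure below 1/2
    and another one for W; evaluating at a common point gives
    conj_transitive. For the local condition, fix V0 with V0^-1 V0 inside V.
    As L0(G) is separable, the class of f is a countable union of pieces
    { f ^ (k_n t) : t mostly in V0 }; by Baire category one piece is dense in
    some open set N of functions with values mostly in U. Suppose the
    condition fails for V and U, and take g in N. Cut the part of
    the space that g sends into U into countably many sets on which g lies in
    a small open W, pick open O1, O2 inside W that V does not connect, and
    replace g there by a constant in O1, respectively in O2. Both new functions
    are in N, hence are approximated by f ^ (k_n t1) and f ^ (k_n t2) from the
    piece. Only five sets of small measure have to
    be avoided to find an x at which t1(x)^-1 t2(x), an element of V, conjugates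
    a point of the O1 chosen at x into the corresponding O2: a contradiction.

    The space [0, 1] enters only through the separability of its measure
    algebra (lebesgue01_separable). *)

Set Implicit Arguments.
Unset Strict Implicit.
Unset Printing Implicit Defensive.

Import Order.TTheory GRing.Theory Num.Theory.

Local Open Scope classical_set_scope.
Local Open Scope ring_scope.

(** * Comeager sets and countable bases *)

Section Comeager.
Context (T : topologicalType).
Implicit Types A B F O : set T.

Lemma nowhere_denseP F : nowhere_dense F <->
  forall O, open O -> O !=set0 -> ~ O `<=` closure F.
Proof.
split=> [F0 O oO [x Ox] OF|nF].
  have : (closure F)° x by apply: filterS OF _; exact: open_nbhs_nbhs.
  by rewrite F0.
apply: contrapT => /eqP/set0P F0.
apply: (nF _ _ F0); first exact: open_interior.
exact: interior_subset.
Qed.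

Lemma nowhere_denseS A B : A `<=` B -> nowhere_dense B -> nowhere_dense A.
Proof.
move=> AB /nowhere_denseP nB; apply/nowhere_denseP => O oO O0 OA.
by apply: (nB O) => //; apply: subset_trans OA _; exact: closure_subset.
Qed.

(** An inclusion is enough: the nowhere dense sets can be cut down to the
    complement of A. *)
Lemma comeagerP A : comeager A <->
  exists2 F : nat -> set T, (forall n, nowhere_dense (F n)) &
                            ~` A `<=` \bigcup_n F n.
Proof.
split=> [[F nF AF]|[F nF AF]]; first by exists F => //; rewrite AF.
exists (fun n => ~` A `&` F n); last first.
  by rewrite -setI_bigcupr; apply/esym/setIidPl.
by move=> n; apply: nowhere_denseS (nF n); exact: subIsetr.
Qed.

Lemma comeagerS A B : A `<=` B -> comeager A -> comeager B.
Proof.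
move=> AB /comeagerP[F nF AF]; apply/comeagerP; exists F => //.
by apply: subset_trans AF; exact: subsetC.
Qed.

Lemma comeager_bigcap (A : nat -> set T) :
  (forall n, comeager (A n)) -> comeager (\bigcap_n A n).
Proof.
move=> cA.
have /choice[F FP] n : exists F : nat -> set T,
    (forall m, nowhere_dense (F m)) /\ ~` A n `<=` \bigcup_m F m.
  by have /comeagerP[F nF AF] := cA n; exists F.
apply/comeagerP; exists (fun k => if unpickle k is Some nm then F nm.1 nm.2
                                  else set0).
  move=> k; case: unpickle => [[n m]|]; first exact: (FP n).1.
  by apply/nowhere_denseP => O oO [x Ox] /(_ x Ox); rewrite closure0.
rewrite setC_bigcap => x [n _ nAx].
have [m _ Fx] := (FP n).2 x nAx.
by exists (pickle (n, m)) => //; rewrite pickleK.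
Qed.

Lemma comeagerT : comeager [set: T].
Proof.
apply/comeagerP; exists (fun=> set0); last by rewrite setCT.
by move=> _; apply/nowhere_denseP => O oO [x Ox] /(_ x Ox); rewrite closure0.
Qed.

Lemma nowhere_dense_comeagerC F : nowhere_dense F -> comeager (~` F).
Proof.
move=> nF; apply/comeagerP; exists (fun=> F) => // x.
by rewrite setCK; exists 0%N.
Qed.

Lemma comeagerI A B : comeager A -> comeager B -> comeager (A `&` B).
Proof.
move=> cA cB; apply: (@comeagerS (\bigcap_n (if n is 0%N then A else B))).
  by move=> x AB; split; [exact: (AB 0%N)|exact: (AB 1%N)].
by apply: comeager_bigcap => -[].
Qed.

End Comeager.

(** With a base indexed by nat, a condition on all neighbourhoods becomes a
    countable intersection, to which comeager_bigcap applies. *)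
Lemma second_countable_basis_seq (T : topologicalType) :
  second_countable (T := T) ->
  exists2 b : nat -> set T, (forall n, open (b n)) &
    forall x U, nbhs x U -> exists2 n, b n x & b n `<=` U.
Proof.
move=> [B cB [oB bB]]; have [f fi] := countable_injP _ cB.
(* Numbers that code no basic set give set0, which no point belongs to. *)
pose b n := xget set0 [set U | B U /\ f U = n].
exists b => [n|x U /bB[V [BV Vx] VU]].
  by rewrite /b; case: xgetP => [V _ [/oB]|_] //; exact: open0.
exists (f V); rewrite /b; case: xgetP => [W _ [BW fW]|/(_ V)[]//].
- by rewrite (fi W V) ?inE.
- by rewrite (fi W V) ?inE.
Qed.

(** * Conjugating generic points by back and forth *)

Section LocallyDense.
Context (R : realType) (G : polishGroupType R).
Implicit Types (x y g : G) (U V W : set G).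

Lemma nbhs_conjgl x g U : nbhs (x ^ g)%g U -> \forall z \near x, U (z ^ g)%g.
Proof.
move=> /(@conjg_continuous R G (x, g))[[P Q] /= [nP nQ] PQ].
apply: filterS nP => z Pz.
by apply: (PQ (z, g)); split=> //=; exact: nbhs_singleton.
Qed.

Lemma nbhs_conjgr x g U : nbhs (x ^ g)%g U -> \forall h \near g, U (x ^ h)%g.
Proof.
move=> /(@conjg_continuous R G (x, g))[[P Q] /= [nP nQ] PQ].
apply: filterS nQ => z Qz.
by apply: (PQ (x, z)); split=> //=; exact: nbhs_singleton.
Qed.

Lemma nbhs_mulgl x g U : nbhs (x * g)%g U -> \forall h \near g, U (x * h)%g.
Proof.
move=> /(@mulg_continuous G (x, g))[[P Q] /= [nP nQ] PQ].
apply: filterS nQ => z Qz.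
by apply: (PQ (x, z)); split=> //=; exact: nbhs_singleton.
Qed.

(** A weak form of the openness that Effros's theorem gives at the points of a
    nonmeager orbit: small conjugators already fill, up to closure, a
    neighbourhood of x. *)
Definition locally_dense_orbit x := forall V, nbhs 1%g V ->
  (closure [set (x ^ v)%g | v in V])° x.

(** Conjugation by g is a homeomorphism that carries the V-orbit of x to the
    (V ^ g)-orbit of x ^ g. *)
Lemma locally_dense_orbitJ x g :
  locally_dense_orbit x -> locally_dense_orbit (x ^ g)%g.
Proof.
move=> lx V V1.
have V'1 : nbhs 1%g [set v | V (v ^ g)%g] by apply: nbhs_conjgl; rewrite conj1g.
have nx : nbhs ((x ^ g) ^ g^-1)%g
    (closure [set (x ^ v)%g | v in [set v | V (v ^ g)%g]]).
  by rewrite conjgK; exact: lx.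
apply: filterS (nbhs_conjgl nx) => y yV B yB.
have [_ [[v /= Vv <-] Bv]] : [set (x ^ v)%g | v in [set v | V (v ^ g)%g]]
    `&` [set z | B (z ^ g)%g] !=set0.
  by apply: yV; apply: nbhs_conjgl; rewrite conjgKV.
by exists ((x ^ v) ^ g)%g; split=> //; exists (v ^ g)%g => //; rewrite -conjJg.
Qed.

Context (d : G -> G -> R).
Context (md : is_metric d) (nd : metrizes d) (cd : complete_metric d).

Lemma nbhs_metric x e : 0 < e -> nbhs x [set y | d x y < e].
Proof. by move=> e0; rewrite nd; exists e. Qed.

(** Extending the conjugator a by a factor v changes it by less than r: the
    distance is measured at a because the complete metric d need not be
    invariant under translations. *)
Definition moved_near x a r :=
  (closure [set ((x ^ a) ^ v)%g | v in [set v | d a (a * v)%g < r]])°.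

Lemma moved_near_refl x a r : 0 < r -> locally_dense_orbit x ->
  moved_near x a r (x ^ a)%g.
Proof.
move=> r0 lx; apply: (locally_dense_orbitJ a lx).
apply: (@nbhs_mulgl a 1%g [set b | d a b < r]).
by rewrite mulg1; exact: nbhs_metric.
Qed.

(** The point y ^ b is a limit of conjugates of x by small extensions a' of a.
    By local density of the orbit of y, it is also interior to the closure of
    its own small conjugates, so a' can be chosen to make x ^ a' land there;
    then the roles of x and y can be exchanged. *)
Lemma back_and_forth_step x a y b r s : 0 < s -> locally_dense_orbit y ->
  moved_near x a r (y ^ b)%g ->
  exists a', [/\ d a a' < r, d (y ^ b)%g (x ^ a')%g < s &
                 moved_near y b s (x ^ a')%g].
Proof.
move=> s0 ly xa.
have nb : nbhs (y ^ b)%g (moved_near y b s `&` [set z | d (y ^ b)%g z < s]).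
  apply: filterI; last exact: nbhs_metric.
  apply: open_nbhs_nbhs.
  by split; [exact: open_interior|exact: moved_near_refl].
have /(_ _ nb)[_ [[v /= vr <-] [yb xv]]] := interior_subset xa.
by exists (a * v)%g; rewrite conjgM.
Qed.

Lemma metric_ge0 x y : 0 <= d x y.
Proof.
by have [d0 _ dC dtri] := md; have := dtri y x x; rewrite d0 (dC y x); lra.
Qed.

Lemma metric_small_eq x y : (forall e, 0 < e -> d x y < e) -> x = y.
Proof.
have [_ dsep _ _] := md; move=> xy; apply: dsep; apply/eqP.
by rewrite eq_le metric_ge0 andbT leNgt; apply/negP => /xy; rewrite ltxx.
Qed.

Lemma metric_limit u l : u @ \oo --> (l : G) ->
  forall e, 0 < e -> \forall n \near \oo, d l (u n) < e.
Proof. by move=> ul e e0; exact: (ul _ (nbhs_metric l e0)). Qed.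

(** The steps at least halve, so the whole tail after n is at most twice the
    step n. *)
Lemma geometric_dist u (r : nat -> R) : (forall n, 2 * r n.+1 <= r n) ->
  (forall n, 0 < r n) -> (forall n, d (u n) (u n.+1) < r n) ->
  forall n k, d (u n) (u (n + k)%N) < 2 * r n.
Proof.
have [d0 _ _ dtri] := md; move=> r2 r0 ur n k.
elim: k n => [|k IH] n; first by rewrite addn0 d0 mulr_gt0.
rewrite (le_lt_trans (dtri (u n.+1) _ _))// addnS -addSn.
by have := ur n; have := IH n.+1; have := r2 n; lra.
Qed.

Lemma geometric_small (r : nat -> R) : (forall n, 2 * r n.+1 <= r n) ->
  (forall n, 0 < r n) ->
  forall e, 0 < e -> exists N, forall n, (N <= n)%N -> r n < e.
Proof.
move=> r2 r0 e e0.
have rn n : n.+1%:R * r n <= r 0%N.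
  elim: n => [|n IH]; first by rewrite mul1r.
  apply: le_trans IH; have : 0 <= n%:R :> R by [].
  have := r2 n; have := r0 n.+1.
  by rewrite -!natr1; nra.
have er : 0 < e / r 0%N by rewrite divr_gt0.
have [N _ NP] := near_infty_natSinv_lt (PosNum er).
exists N => n /NP /=; rewrite ltr_pdivlMr//; apply: le_lt_trans.
by rewrite mulrC ler_pdivlMr// mulrC.
Qed.

Lemma geometric_cvg u (r : nat -> R) : (forall n, 2 * r n.+1 <= r n) ->
  (forall n, 0 < r n) -> (forall n, d (u n) (u n.+1) < r n) ->
  exists l, u @ \oo --> (l : G).
Proof.
have [d0 _ dC dtri] := md; move=> r2 r0 ur; apply: cd => e e0.
have e4 : 0 < e / 4 by rewrite divr_gt0.
have [N NP] := geometric_small r2 r0 e4; exists N => m n Nm Nn.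
have uN k : (N <= k)%N -> d (u N) (u k) < e / 2.
  move=> /subnKC <-; apply: lt_trans (geometric_dist r2 r0 ur _ _) _.
  by have := NP _ (leqnn N); lra.
have := dtri (u N) (u m) (u n); rewrite (dC (u m) (u N)).
by have := uN _ Nm; have := uN _ Nn; lra.
Qed.

(** Back and forth. As the orbit of y is dense, some y ^ b starts in the region
    approached by small conjugates of x. Alternating back_and_forth_step yields
    conjugators a_n of x and b_n of y, each sequence Cauchy for d, with
    x ^ a_n.+1 and y ^ b_n ever closer; in the limit x ^ l = y ^ m. *)
Lemma locally_dense_orbits_conj x y :
  (forall U, open U -> U !=set0 -> exists g, U (y ^ g)%g) ->
  locally_dense_orbit x -> locally_dense_orbit y -> exists g, y = (x ^ g)%g.
Proof.
have [_ dsep dC dtri] := md; move=> yd lx ly.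
pose r n : R := 2^-1 ^+ n.
have r0 n : 0 < r n by rewrite exprn_gt0.
have r2 n : 2 * r n.+1 <= r n by rewrite /r exprS mulrA divff ?mul1r.
(* A state (n, (a, b)) records the step and the current conjugators; it is good
   when the next small extension of a can bring x ^ a back to y ^ b. *)
pose good (s : nat * (G * G)) := moved_near x s.2.1 (r s.1) (y ^ s.2.2)%g.
pose next (s t : nat * (G * G)) := [/\ t.1 = s.1.+1,
  d s.2.1 t.2.1 < r s.1, d s.2.2 t.2.2 < r s.1 &
  d (y ^ s.2.2)%g (x ^ t.2.1)%g < r s.1].
have step (s : {s | good s}) : {t : {s | good s} | next (sval s) (sval t)}.
  apply: cid; case: s => -[n [a b]] /= nab.
  have [a' [aa' bxa' xa']] := back_and_forth_step (r0 n.+1) ly nab.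
  have [b' [bb' _ yb']] := back_and_forth_step (r0 n.+1) lx xa'.
  have rn : r n.+1 < r n by have := r2 n; have := r0 n.+1; lra.
  exists (exist _ (n.+1, (a', b')) yb'); split=> //=.
    exact: lt_trans rn.
  exact: lt_trans rn.
have [b0 yb0] : exists b, moved_near x 1%g (r 0%N) (y ^ b)%g.
  apply: yd; first exact: open_interior.
  by exists (x ^ 1)%g; apply: moved_near_refl.
have [f [f0 fn]] := dependent_choice step (exist good (0%N, (1%g, b0)) yb0).
pose a n := (sval (f n)).2.1; pose b n := (sval (f n)).2.2.
have fE n : (sval (f n)).1 = n.
  by elim: n => [|n IH]; [rewrite f0|have [-> _ _ _] := fn n; rewrite IH].
have [l al] : exists l, a @ \oo --> (l : G).
  by apply: (geometric_cvg r2) => // n; have [_] := fn n; rewrite fE.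
have [m bm] : exists m, b @ \oo --> (m : G).
  by apply: (geometric_cvg r2) => // n; have [_ _] := fn n; rewrite fE.
suff xy : (x ^ l)%g = (y ^ m)%g.
  by exists (l * m^-1)%g; rewrite conjgM xy conjgK.
have xal : (fun n => x ^ a n)%g @ \oo --> (x ^ l)%g.
  by move=> U /nbhs_conjgr/al.
have ybm : (fun n => y ^ b n)%g @ \oo --> (y ^ m)%g.
  by move=> U /nbhs_conjgr/bm.
apply: metric_small_eq => e e0.
have e3 : 0 < e / 3 by rewrite divr_gt0.
have [Nx _ Px] := metric_limit xal e3; have [Ny _ Py] := metric_limit ybm e3.
have [Nr Pr] := geometric_small r2 r0 e3.
pose n := (Nx + Ny + Nr)%N.
have /Px/= dx : (Nx <= n.+1)%N by rewrite /n; lia.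
have /Py/= dy : (Ny <= n)%N by rewrite /n; lia.
have /Pr/= dr : (Nr <= n)%N by rewrite /n; lia.
have [_ _ _] := fn n; rewrite -/(a n.+1) -/(b n) fE => dn.
have := dtri (x ^ a n.+1)%g (x ^ l)%g (y ^ m)%g.
have := dtri (y ^ b n)%g (x ^ a n.+1)%g (y ^ m)%g.
by rewrite (dC (x ^ a n.+1)%g (y ^ b n)%g) (dC (y ^ b n)%g (y ^ m)%g); lra.
Qed.

End LocallyDense.

(** * A criterion for a comeager conjugacy class *)

Section Criterion.
Context (R : realType) (G : polishGroupType R).
Implicit Types (x y g : G) (U V W : set G).

Definition conj_transitive := forall U W, open U -> U !=set0 ->
  open W -> W !=set0 -> exists x g, U x /\ W (x ^ g)%g.

Definition conj_mixes V W := forall O1 O2, open O1 -> O1 !=set0 -> O1 `<=` W ->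
  open O2 -> O2 !=set0 -> O2 `<=` W ->
  exists x v, [/\ O1 x, V v & O2 (x ^ v)%g].

Definition conj_locally_transitive := forall V U, nbhs 1%g V -> open U ->
  U !=set0 -> exists W, [/\ open W, W !=set0, W `<=` U & conj_mixes V W].

(** For each basic b n, the points with no conjugate in b n form a nowhere dense
    set: by transitivity any open set has a point with a conjugate in b n, and
    by continuity the same conjugator works nearby. *)
Lemma comeager_dense_orbits : conj_transitive ->
  comeager [set y : G | forall U, open U -> U !=set0 -> exists g, U (y ^ g)%g].
Proof.
move=> tr.
have [b ob bb] := second_countable_basis_seq (@polish_second_countable R G).
apply: (@comeagerS _
  (\bigcap_n [set y | b n !=set0 -> exists g, b n (y ^ g)%g])).
  move=> y yb U oU [x Ux].
  have [n bx bU] := bb x U (open_nbhs_nbhs (conj oU Ux)).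
  have [|g yg] := yb n I; first by exists x.
  by exists g; exact: bU.
apply: comeager_bigcap => n.
have [b0|nb0] := pselect (b n !=set0); last first.
  by apply: comeagerS (@comeagerT G) => y _ /nb0.
apply: (@comeagerS _ (~` [set y | forall g, ~ b n (y ^ g)%g])).
  by move=> y /= /existsNP[g /contrapT yg] _; exists g.
apply/nowhere_dense_comeagerC/nowhere_denseP => O oO O0 Ob.
have [x [g [Ox bxg]]] := tr O _ oO O0 (ob n) b0.
have nx : nbhs x [set z | b n (z ^ g)%g].
  by apply: nbhs_conjgl; apply: open_nbhs_nbhs.
by have [z [/(_ g) nz /nz]] := Ob x Ox _ nx.
Qed.

(** If x lies in a basic b n on which b k mixes, then b n is a neighbourhood of
    x inside the closure of the b k-orbit of x as soon as that orbit hits every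
    basic b m inside b n. Failing to lie in such a b n, and failing to hit a
    given b m, are both nowhere dense conditions. *)
Lemma comeager_locally_dense_orbits : conj_locally_transitive ->
  comeager [set x : G | locally_dense_orbit x].
Proof.
move=> lt.
have [b ob bb] := second_countable_basis_seq (@polish_second_countable R G).
pose in_mixed k :=
  [set x | b k 1%g -> exists2 n, b n x & conj_mixes (b k) (b n)].
pose hits k n m := [set x | conj_mixes (b k) (b n) -> b m `<=` b n ->
  b m !=set0 -> b n x -> exists2 v, b k v & b m (x ^ v)%g].
apply: (@comeagerS _ (\bigcap_k
    (in_mixed k `&` \bigcap_n \bigcap_m (hits k n m)))).
  move=> x Cx V V1; have [k k1 kV] := bb _ _ V1.
  have [/(_ k1)[n bx mx] hx] := Cx k I.
  have : nbhs x (b n) by exact: open_nbhs_nbhs.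
  apply: filterS => y bny B yB.
  have nyn := open_nbhs_nbhs (conj (ob n) bny).
  have [m bmy bmB] := bb y (B `&` b n) (filterI yB nyn).
  have [v kv bmv] : exists2 v, b k v & b m (x ^ v)%g.
    by apply: (hx n I m I) => // [z /bmB[]|]; last by exists y.
  exists (x ^ v)%g; split; last by case: (bmB _ bmv).
  by exists v => //; exact: kV.
apply: comeager_bigcap => k; apply: comeagerI.
  have [k1|nk1] := pselect (b k 1%g); last first.
    by apply: comeagerS (@comeagerT G) => y _ /nk1.
  apply: (@comeagerS _
    (~` [set x | forall n, conj_mixes (b k) (b n) -> ~ b n x])).
    move=> x /= nx _; apply: contrapT => nx'; apply: nx => n mn bx.
    by apply: nx'; exists n.
  apply/nowhere_dense_comeagerC/nowhere_denseP => O oO O0 Ob.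
  have [W [oW [x Wx] WO mW]] := lt _ O (open_nbhs_nbhs (conj (ob k) k1)) oO O0.
  have [n bnx nW] := bb x W (open_nbhs_nbhs (conj oW Wx)).
  have nxn := open_nbhs_nbhs (conj (ob n) bnx).
  have [z [/(_ n) nz /nz]] := Ob x (WO _ Wx) _ nxn.
  by apply=> O1 O2 oO1 O10 O1n oO2 O20 O2n;
    apply: mW => //; [apply: subset_trans O1n _|apply: subset_trans O2n _].
apply: comeager_bigcap => n; apply: comeager_bigcap => m.
have [[mx mn m0]|nh] := pselect ([/\ conj_mixes (b k) (b n),
    b m `<=` b n & b m !=set0]); last first.
  by apply: comeagerS (@comeagerT G) => y _ ? ? ?; case: nh.
apply: (@comeagerS _
  (~` [set x | b n x /\ forall v, b k v -> ~ b m (x ^ v)%g])).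
  move=> x /= nx _ _ _ bx; apply: contrapT => nx'; apply: nx.
  by split=> // v kv mv; apply: nx'; exists v.
apply/nowhere_dense_comeagerC/nowhere_denseP => O oO [x0 Ox0] Ob.
have [z [[nz _] Oz]] := Ob x0 Ox0 _ (open_nbhs_nbhs (conj oO Ox0)).
have [x [v [[Ox nx] kv mxv]]] :
    exists x v, [/\ (O `&` b n) x, b k v & b m (x ^ v)%g].
  apply: mx => //; [exact: openI|by exists z].
have nx' : nbhs x [set z | b m (z ^ v)%g].
  by apply: nbhs_conjgl; apply: open_nbhs_nbhs.
by have [t [[_ /(_ v kv) nt] /nt]] := Ob x Ox _ nx'.
Qed.

(** The generic points all lie in one class by locally_dense_orbits_conj, so
    that class is comeager. *)
Lemma comeager_conjugacy_class_criterion :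
  conj_transitive -> conj_locally_transitive ->
  has_comeager_conjugacy_class G.
Proof.
move=> /comeager_dense_orbits cd /comeager_locally_dense_orbits cl.
have [d [md nd ccd]] := @polish_completely_metrizable R G.
have := comeagerI cd cl; set C := (X in comeager X) => cC.
have [[x [xd xl]]|C0] := pselect (C !=set0).
  exists x; apply: comeagerS cC => y [yd yl].
  by have [g ->] := locally_dense_orbits_conj md nd ccd yd xl yl; exists g.
(* If no point were generic, the empty set would be comeager, and every class
   with it. *)
exists 1%g; apply: comeagerS cC => y Cy; case: C0; by exists y.
Qed.

End Criterion.

(** * Properties that hold off a set of small measure *)

Section Mostly.
Context d (T : measurableType d) (R : realType) (mu : probability T R).
Implicit Types (P Q A : set T) (e : R).

(** P holds off a measurable set of measure below e. Since P itself may be any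
    set, such properties can be intersected and changed almost everywhere
    without side conditions. *)
Definition mostly e P :=
  exists A, [/\ measurable A, (mu A < e%:E)%E & forall x, ~ A x -> P x].

Lemma mostly_ae e P Q : (\forall x \ae mu, P x -> Q x) ->
  mostly e P -> mostly e Q.
Proof.
move=> [N [mN N0 NPQ]] [A [mA Ae AP]]; exists (A `|` N); split.
- exact: measurableU.
- by rewrite measureU0.
- move=> x /not_orP[/AP Px nN]; apply: contrapT => nQ; apply: nN; apply: NPQ.
  by move=> /(_ Px).
Qed.

Lemma mostlyS e P Q : P `<=` Q -> mostly e P -> mostly e Q.
Proof. by move=> PQ; apply: mostly_ae; apply: aeW => x; exact: PQ. Qed.

Lemma mostly_le e e' P : e <= e' -> mostly e P -> mostly e' P.
Proof.
move=> ee [A [mA Ae AP]]; exists A; split => //.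
by apply: lt_le_trans Ae _; rewrite lee_fin.
Qed.

Lemma ae_mostly e P : 0 < e -> (\forall x \ae mu, P x) -> mostly e P.
Proof.
move=> e0 aP; apply: (@mostly_ae _ setT); first by apply: filterS aP.
by exists set0; rewrite measure0 lte_fin.
Qed.

Lemma mostlyI e e' P Q : mostly e P -> mostly e' Q -> mostly (e + e') (P `&` Q).
Proof.
move=> [A [mA Ae AP]] [B [mB Be BQ]]; exists (A `|` B); split.
- exact: measurableU.
- by apply: le_lt_trans (measureU2 _ mA mB) _; rewrite EFinD lteD.
- by move=> x /not_orP[/AP ? /BQ].
Qed.

Lemma mostly_ex e P : e <= 1 -> mostly e P -> exists x, P x.
Proof.
move=> e1 [A [mA Ae AP]]; apply: contrapT => nP.
have A1 : A = setT.
  apply/seteqP; split=> // x _.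
  by apply: contrapT => /AP Px; apply: nP; exists x.
by move: Ae; rewrite A1 probability_setT lte_fin ltNge e1.
Qed.

Lemma mostlyP e P : measurable P -> mostly e P <-> (mu (~` P) < e%:E)%E.
Proof.
move=> mP; split=> [[A [mA Ae AP]]|Pe].
  apply: le_lt_trans Ae; apply: le_measure; rewrite ?inE//.
    exact: measurableC.
  by move=> x nPx; apply: contrapT => /AP.
exists (~` P); split=> //; first exact: measurableC.
by move=> x /contrapT.
Qed.

Lemma mostly_bigcap (P : nat -> set T) (s : nat -> R) c e :
  (forall n, mostly (s n) (P n)) -> (forall k, \sum_(0 <= i < k) s i <= c) ->
  c < e -> mostly e (\bigcap_n P n).
Proof.
move=> /choice[A AP] sc ce; exists (\bigcup_n A n).
have mA n : measurable (A n) by have [] := AP n.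
have mU : measurable (\bigcup_n A n) by exact: bigcupT_measurable.
split=> //; last first.
  move=> x nA n _; have [_ _] := AP n; apply=> An; apply: nA; by exists n.
apply: (@le_lt_trans _ _ c%:E); last by rewrite lte_fin.
apply: le_trans (le_mu_bigcup _ mA mU) _.
apply: lime_le; first by apply: is_cvg_nneseries => *; exact: measure_ge0.
apply: nearW => k; apply: (@le_trans _ _ (\sum_(0 <= i < k) s i)%:E).
  rewrite -sumEFin; apply: lee_sum => i _; have [_ /ltW] := AP i; exact.
by rewrite lee_fin.
Qed.

(** Continuity from above of the finite measure mu, on the complements. *)
Lemma mostly_exhaust (F : nat -> set T) e : (forall n, measurable (F n)) ->
  (forall m n, (m <= n)%N -> F m `<=` F n) -> (forall x, exists n, F n x) ->
  0 < e -> exists n, mostly e (F n).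
Proof.
move=> mF Fmn FT e0.
have mFC n : measurable (~` F n) by exact: measurableC.
have F0 : \bigcap_n ~` F n = set0.
  apply/seteqP; split=> // x Fx; have [n] := FT x.
  exact: (Fx n I).
have : mu \o (fun n => ~` F n) @ \oo --> mu (\bigcap_n ~` F n).
  apply: nonincreasing_cvg_mu => //.
  - by rewrite (le_lt_trans (probability_le1 mu (mFC 0%N)))// ltry.
  - by rewrite F0.
  - by move=> m n mn; apply/subsetPset; apply: subsetC; exact: Fmn.
rewrite F0 measure0 => /fine_cvgP[_ /cvgrPdist_lt /(_ _ e0)].
move=> [n _ /(_ n (leqnn _))] /=.
rewrite sub0r normrN ger0_norm ?fine_ge0// => Fn; exists n; apply/mostlyP => //.
rewrite -[X in (X < _)%E]fineK ?lte_fin//.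
exact: (fin_num_measure mu _ (mFC n)).
Qed.

(** Countable choice of an index can be made measurably: take the least one. *)
Lemma measurable_index (A : nat -> set T) : (forall n, measurable (A n)) ->
  (forall x, exists n, A n x) ->
  exists2 i : T -> nat, (forall k, measurable [set x | i x = k]) &
                        forall x, A (i x) x.
Proof.
move=> mA AT.
have Ab x : exists n, `[< A n x >].
  by have [n An] := AT x; exists n; exact/asboolP.
exists (fun x => ex_minn (Ab x)) => [k|x]; last by case: ex_minnP => n /asboolP.
rewrite (_ : [set x | _] = seqDU A k); first exact: seqDU_measurable.
rewrite /seqDU -bigcup_mkord; apply/seteqP; split=> x /=.
  case: ex_minnP => n /asboolP An nmin <-; split=> // -[j /= jn Aj].
  by have := nmin j (asboolT Aj); rewrite leqNgt jn.
move=> [Ak nA]; case: ex_minnP => n /asboolP An nmin.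
apply/eqP; rewrite eqn_leq nmin ?(asboolT Ak)//= leqNgt; apply/negP => nk.
by apply: nA; exists n.
Qed.

End Mostly.

(** * Convergence in measure *)

Section L0Metric.
Context d (T : measurableType d) (R : realType) (mu : probability T R).
Context (G : polishGroupType R).
Local Notation L0G := (L0 mu G).
Implicit Types (f g h : L0G) (U V W : set G) (e r : R).
Local Notation mostly := (mostly mu).

Lemma L0_of_fun (u : T -> G) : (forall U, open U -> measurable (u @^-1` U)) ->
  exists f : L0G, \forall x \ae mu, f x = u x.
Proof.
move=> mu_; have mF : measurable_fun setT (u : T -> borel G).
  exact: borel_measurable.
pose u' : {mfun T >-> borel G} :=
  mfun_Sub (mem_set mF : (u : T -> borel G) \in mfun).
by exists (L0_pi mu u'); exact: (L0_piE mu u').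
Qed.

Lemma L0_cst (y : G) : exists f : L0G, \forall x \ae mu, f x = y.
Proof.
by apply: (@L0_of_fun (fun=> y)) => U oU; rewrite preimage_cst; case: ifP.
Qed.

Lemma L0_glue (i : T -> nat) (u : nat -> L0G) :
  (forall k, measurable [set x | i x = k]) ->
  exists f : L0G, \forall x \ae mu, f x = u (i x) x.
Proof.
move=> mi; apply: (@L0_of_fun (fun x => u (i x) x)) => U oU.
rewrite (_ : _ @^-1` U = \bigcup_k ([set x | i x = k] `&` u k @^-1` U)).
  apply: bigcupT_measurable => k.
  by apply: measurableI => //; exact: L0_measurable.
apply/seteqP; split=> [x Ux|x [k _ [<-]]//].
by exists (i x).
Qed.

Lemma L0_ballP V e h : open V -> L0_ball V e h <-> mostly e [set x | V (h x)].
Proof.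
by move=> oV; symmetry; apply: mostlyP; exact: L0_measurable.
Qed.

(** A threshold that exists locally around each point of G, hence depends on the
    value f x, is the same for most x. *)
Lemma mostly_uniform (P : nat -> set G) f e :
  (forall m n, (m <= n)%N -> P m `<=` P n) ->
  (forall y : G, exists n, \forall z \near y, P n z) ->
  0 < e -> exists n, mostly e [set x | P n (f x)].
Proof.
move=> Pmn PT e0.
pose F n := [set x | (P n)° (f x)].
have [||x||n Pn] := @mostly_exhaust _ _ _ mu F e.
- by move=> n; apply: L0_measurable; exact: open_interior.
- by move=> m n mn x; apply: interiorS; exact: Pmn.
- by have [n Pn] := PT (f x); exists n.
- by [].
by exists n; apply: mostlyS Pn => x /=; exact: interior_subset.
Qed.

Context (dist : G -> G -> R).
Context (md : is_metric dist) (nd : metrizes dist) (cd : complete_metric dist).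

(** The balls of the Ky Fan metric of convergence in measure. *)
Definition L0_close r f g := mostly r [set x | dist (f x) (g x) < r].

Let invS_gt0 n : 0 < n.+1%:R^-1 :> R. Proof. by rewrite invr_gt0 ltr0Sn. Qed.

Let invS_lt e : 0 < e -> exists n, n.+1%:R^-1 < e.
Proof.
move=> e0; have [n _ /(_ n (leqnn _))] := near_infty_natSinv_lt (PosNum e0).
by exists n.
Qed.

Let invS_le m n : (m <= n)%N -> n.+1%:R^-1 <= m.+1%:R^-1 :> R.
Proof. by move=> mn; rewrite lef_pV2 ?posrE// ler_nat. Qed.

Lemma open_metric_ball (y : G) r : open [set z | dist y z < r].
Proof.
have [_ _ _ dtri] := md; rewrite openE => z /= yz; rewrite /interior nd.
exists (r - dist y z) => /=; first by rewrite subr_gt0.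
by move=> t /=; rewrite ltrBrDl; apply: le_lt_trans.
Qed.

(** The topology of L0(G) is given by left translates, while dist need not be
    left invariant. At a value y the two notions of smallness are comparable
    by continuity, with constants that depend on y; mostly_uniform makes
    them uniform. *)
Lemma nbhs_L0_close f (A : set L0G) : nbhs f A ->
  exists2 r, 0 < r & forall g, L0_close r f g -> A g.
Proof.
have [_ _ dC dtri] := md.
move=> /L0_nbhsP[V [e [[oV V1] e0 VA]]].
pose P n y := forall z, dist y z < n.+1%:R^-1 -> V (y^-1 * z)%g.
have e2 : 0 < e / 2 by rewrite divr_gt0.
have [m n mn y Py z yz|y||n Pn] := @mostly_uniform P f (e / 2).
- by apply: Py; apply: lt_le_trans yz (invS_le mn).
- have : nbhs ((y^-1)%g, y) [set p : G * G | V (p.1 * p.2)%g].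
    apply: (@mulg_continuous G ((y^-1)%g, y) V).
    by rewrite /= mulVg; exact: open_nbhs_nbhs.
  move=> [[A1 A2] /= [n1 n2] A12].
  have n1' : nbhs y [set z | A1 (z^-1)%g] by exact: (@invg_continuous G y).
  move: (n2); rewrite nd => -[r /= r0 rA].
  have r2 : 0 < r / 2 by rewrite divr_gt0.
  have [n nr] := invS_lt r2; exists n.
  apply: filterS (filterI n1' (nbhs_metric nd y r2)) => z [/= A1z yz] t zt.
  apply: (A12 ((z^-1)%g, t)); split=> //=; apply: rA => /=.
  by have := dtri z y t; have := lt_trans zt nr; lra.
- by [].
exists (Num.min (e / 2) n.+1%:R^-1); first by rewrite lt_min e2 invS_gt0.
move=> g fg; rewrite (_ : g = f * (f^-1 * g))%g; last first.
  by rewrite mulgA mulgV mul1g.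
apply: VA; apply/L0_ballP => //.
have fg' : mostly (e / 2) [set x | dist (f x) (g x) < n.+1%:R^-1].
  apply: (@mostly_le _ _ _ _ (Num.min (e / 2) n.+1%:R^-1)).
    by rewrite ge_min lexx.
  by apply: mostlyS fg => x /=; rewrite lt_min => /andP[].
rewrite [e]splitr; apply: mostly_ae (mostlyI Pn fg').
near=> x => -[/= Px /Px].
rewrite (near (L0_ME (f^-1)%g g) x)// (near (L0_VE f) x)//.
Unshelve. all: by end_near. Qed.

(** The converse comparison, for the same reason. *)
Lemma L0_close_nbhs f r : 0 < r -> nbhs f [set g | L0_close r f g].
Proof.
move=> r0; apply/L0_nbhsP.
have [d0 _ dC dtri] := md.
pose P n (y : G) :=
  forall t : G, dist 1%g t < n.+1%:R^-1 -> dist y (y * t)%g < r.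
have r2 : 0 < r / 2 by rewrite divr_gt0.
have [m n mn y Py z yz|y||n Pn] := @mostly_uniform P f (r / 2).
- by apply: Py; apply: lt_le_trans yz (invS_le mn).
- have : nbhs (y, 1%g : G) [set p : G * G | dist y (p.1 * p.2)%g < r / 2].
    apply: (@mulg_continuous G (y, 1%g) [set z | dist y z < r / 2]).
    by rewrite /= mulg1; exact: (nbhs_metric nd).
  move=> [[A1 A2] /= [n1 n2] A12].
  move: (n2); rewrite nd => -[s /= s0 sA].
  have [n ns] := invS_lt s0; exists n.
  apply: filterS (filterI n1 (nbhs_metric nd y r2)) => z [/= A1z yz] t t1.
  have := A12 (z, t) (conj A1z (sA t (lt_trans t1 ns))).
  by have := dtri y z (z * t)%g; rewrite /= (dC z y); lra.
- by [].
exists [set h | dist 1%g h < n.+1%:R^-1], (r / 2); split=> //.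
  by split; [exact: open_metric_ball|rewrite /= d0].
move=> h /L0_ballP hn; rewrite /L0_close /= [X in mostly X _]splitr.
apply: mostly_ae (mostlyI Pn (hn (open_metric_ball _ _))).
by near=> x => -[/= Px /Px]; rewrite (near (L0_ME f h) x).
Unshelve. all: by end_near. Qed.

(** Each g x has a ball inside the open set assigned to x; its radius can be
    taken the same for most x, whence an L0_close ball around g. *)
Lemma nbhs_mostly_in (i : T -> nat) (W : nat -> set G) g e :
  (forall k, measurable [set x | i x = k]) -> (forall k, open (W k)) ->
  (\forall x \ae mu, W (i x) (g x)) -> 0 < e ->
  nbhs g [set h | mostly e [set x | W (i x) (h x)]].
Proof.
move=> mi oW Wg e0; have [d0 _ _ dtri] := md.
have e2 : 0 < e / 2 by rewrite divr_gt0.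
pose B n k := [set y : G | forall z, dist y z < n.+1%:R^-1 -> W k z]°.
pose F n := [set x | W (i x) (g x) -> B n (i x) (g x)].
have [n|m n mn x Fm /Fm|x||n Fn] := @mostly_exhaust _ _ _ mu F (e / 2).
- rewrite (_ : F n = \bigcup_k ([set x | i x = k] `&`
      (~` (g @^-1` W k) `|` g @^-1` B n k))).
    apply: bigcupT_measurable => k; apply: measurableI => //.
    apply: measurableU; last by apply: L0_measurable; exact: open_interior.
    by apply: measurableC; exact: L0_measurable.
  apply/seteqP; split=> [x Fx|x [k _ [<- /= [nW /nW|Bx _]]]]; [|by []|by []].
  exists (i x) => //; split=> //.
  by have [/Fx|nW] := pselect (W (i x) (g x)); [right|left].
- apply: interiorS => y By z yz; apply: By.
  exact: lt_le_trans yz (invS_le mn).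
- have [Wx|nW] := pselect (W (i x) (g x)); last by exists 0%N => /nW.
  have : nbhs (g x) (W (i x)) by exact: open_nbhs_nbhs.
  rewrite nd => -[r /= r0 rW]; have r2 : 0 < r / 2 by rewrite divr_gt0.
  have [n nr] := invS_lt r2; exists n => _.
  apply: filterS (nbhs_metric nd (g x) r2) => y /= xy z yz; apply: rW => /=.
  by have := dtri y (g x) z; have := lt_trans yz nr; lra.
- by [].
pose r := Num.min (e / 2) n.+1%:R^-1.
have r0 : 0 < r by rewrite lt_min e2 invS_gt0.
apply: filterS (L0_close_nbhs g r0) => h gh.
have gh' : mostly (e / 2) [set x | dist (g x) (h x) < n.+1%:R^-1].
  apply: (@mostly_le _ _ _ _ r); first by rewrite /r ge_min lexx.
  by apply: mostlyS gh => x /=; rewrite lt_min => /andP[].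
rewrite /= [e]splitr; apply: mostly_ae (mostlyI Fn gh').
by apply: filterS Wg => x Wx [/(_ Wx)/interior_subset Bx gx]; exact: Bx.
Qed.

Lemma nbhs_mostly_in_cst (W : set G) g e : open W ->
  (\forall x \ae mu, W (g x)) -> 0 < e ->
  nbhs g [set h | mostly e [set x | W (h x)]].
Proof.
move=> oW Wg; apply: (@nbhs_mostly_in (fun=> 0%N) (fun=> W)) => // k.
have [<-|k0] := eqVneq 0%N k.
  by rewrite (_ : [set _ | _] = setT)//; apply/seteqP; split.
rewrite (_ : [set _ | _] = set0)//; apply/seteqP; split=> // x /= /eqP.
by rewrite (negPf k0).
Qed.

Lemma open_dist_lt r : open [set p : G * G | dist p.1 p.2 < r].
Proof.
have [_ _ dC dtri] := md; rewrite openE => -[y z] /= yz.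
have e0 : 0 < (r - dist y z) / 2 by rewrite divr_gt0// subr_gt0.
exists ([set t | dist y t < (r - dist y z) / 2],
        [set t | dist z t < (r - dist y z) / 2]).
  by split; exact: (nbhs_metric nd).
move=> [y' z'] /= [yy' zz'].
by have := dtri y y' z'; have := dtri z y z'; rewrite (dC y' y); lra.
Qed.

Lemma measurable_L0_dist f g r : measurable [set x | dist (f x) (g x) < r].
Proof.
have mf (k : L0G) : measurable_fun setT (k : T -> borel G).
  by apply: borel_measurable => U; exact: L0_measurable.
by have := measurable_pair_preimage (mf f) (mf g) (open_dist_lt (r := r)).
Qed.

Lemma L0_close_le f g r r' : r <= r' -> L0_close r f g -> L0_close r' f g.
Proof.
move=> rr' fg; apply: (mostly_le rr'); apply: mostlyS fg => x /= fgx.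
exact: lt_le_trans fgx rr'.
Qed.

(** For x in A, the limit at x lies in the open set U exactly when, for some m,
    the sequence at x finally stays in the open set B m, all of whose points are
    at distance at least 1 / m.+1 from the complement of U. This expresses the
    preimage of U by countable operations. *)
Lemma measurable_lim (f : nat -> L0G) (A : set T) : measurable A ->
  (forall x, A x -> exists l : G, f ^~ x @ \oo --> l) ->
  exists g : L0G, \forall x \ae mu, A x -> f ^~ x @ \oo --> g x.
Proof.
move=> mA fl; have [_ _ dC dtri] := md.
have /choice[u uP] x : exists y : G,
    (A x -> f ^~ x @ \oo --> y) /\ (~ A x -> y = 1%g).
  have [Ax|nA] := pselect (A x); last by exists 1%g.
  by have [l xl] := fl x Ax; exists l.
suff /L0_of_fun[g gu] U : open U -> measurable (u @^-1` U).
  by exists g; apply: filterS gu => x -> /(uP x).1.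
move=> oU.
pose B m := [set y : G | forall z, dist y z < m.+1%:R^-1 -> U z]°.
rewrite (_ : u @^-1` U =
    (A `&` \bigcup_m \bigcup_N \bigcap_k (f (N + k)%N @^-1` B m))
    `|` (~` A `&` [set _ | U 1%g])).
  apply: measurableU; apply: measurableI => //; last 2 first.
  - exact: measurableC.
  - have [U1|nU1] := pselect (U 1%g).
      by rewrite (_ : [set _ | _] = setT)//; apply/seteqP; split.
    by rewrite (_ : [set _ | _] = set0)//; apply/seteqP; split.
  apply: bigcupT_measurable => m; apply: bigcupT_measurable => N.
  apply: bigcapT_measurable => k; apply: L0_measurable; exact: open_interior.
apply/seteqP; split=> x /=; last first.
  move=> [[Ax [m _ [N _ Bx]]]|[nA U1]]; last by rewrite (uP x).2.
  have := metric_limit nd ((uP x).1 Ax) (invS_gt0 m) => -[M _ /(_ (N + M)%N)].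
  rewrite /= leq_addl dC => /(_ isT).
  by apply: (interior_subset (Bx M I)).
move=> Ux; have [Ax|nA] := pselect (A x); last first.
  by right; split=> //; rewrite -((uP x).2 nA).
left; split=> //.
have : nbhs (u x) U by exact: open_nbhs_nbhs.
rewrite nd => -[r /= r0 rU]; have r2 : 0 < r / 2 by rewrite divr_gt0.
have [m mr] := invS_lt r2; exists m => //.
have nB : nbhs (u x) (B m).
  apply: open_nbhs_nbhs; split; first exact: open_interior.
  apply: filterS (nbhs_metric nd (u x) r2) => y /= xy z yz; apply: rU => /=.
  by have := dtri y (u x) z; have := lt_trans yz mr; lra.
have [N _ NP] := (uP x).1 Ax _ nB.
by exists N => // k _; apply: NP; rewrite /= leq_addr.
Qed.

(** By Borel-Cantelli, for almost every x the steps at x are finally below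
    r n / 4, hence f n x converges. The tail after n costs at most r n / 2, both
    in distance and in measure. *)
Lemma L0_complete (f : nat -> L0G) (r : nat -> R) : (forall n, 0 < r n) ->
  (forall n, 2 * r n.+1 <= r n) ->
  (forall n, L0_close (r n / 4) (f n) (f n.+1)) ->
  exists g : L0G, forall n, L0_close (r n) (f n) g.
Proof.
move=> r0 r2 fr; have [_ _ dC dtri] := md.
pose E n := [set x | dist (f n x) (f n.+1 x) < r n / 4].
pose A n := \bigcap_k E (n + k)%N.
have mA n : measurable (A n).
  by apply: bigcapT_measurable => k; exact: measurable_L0_dist.
have mostlyA n : mostly (r n) (A n).
  apply: (@mostly_bigcap _ _ _ _ _ (fun k => r (n + k)%N / 4) (r n / 2)).
  - by move=> k; exact: fr.
  - move=> k.
    suff : \sum_(0 <= i < k) r (n + i)%N / 4 <= r n / 2 - r (n + k)%N / 2.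
      by have := r0 (n + k)%N; lra.
    elim: k => [|k IH]; first by rewrite big_nil addn0; lra.
    by rewrite big_nat_recr//= addnS; have := r2 (n + k)%N; lra.
  - by have := r0 n; lra.
have cvgA n x : A n x -> exists l : G, f ^~ x @ \oo --> l.
  move=> Ax; have r4 k : 0 < r (n + k)%N / 4 by rewrite divr_gt0.
  have [|//|k|l fl] := @geometric_cvg R G dist md cd
    (fun k => f (n + k)%N x) (fun k => r (n + k)%N / 4).
  - by move=> k; rewrite addnS; have := r2 (n + k)%N; lra.
  - by rewrite addnS; exact: Ax.
  exists l => U /fl[N _ NP]; exists (n + N)%N => // m /= nm.
  rewrite -(subnKC (leq_trans (leq_addr N n) nm)); apply: NP => /=.
  by rewrite leq_subRL// (leq_trans (leq_addr N n)).
have [|x [n _ /cvgA]//|g gP] := @measurable_lim f (\bigcup_n A n).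
  by apply: bigcupT_measurable => n; exact: mA.
exists g => n; apply: mostly_ae (mostlyA n); apply: filterS gP => x xP Ax /=.
have /xP fg : (\bigcup_n A n) x by exists n.
have r4 : 0 < r n / 4 by rewrite divr_gt0.
have [N _ /(_ (n + N)%N)/=] := metric_limit nd fg r4.
rewrite leq_addl dC => /(_ isT) Ng.
have : dist (f n x) (f (n + N)%N x) < 2 * (r n / 4).
  have := @geometric_dist R G dist md
    (fun k => f (n + k)%N x) (fun k => r (n + k)%N / 4).
  move=> /(_ _ _ _ 0%N N); rewrite !addn0 add0n; apply=> k.
  - by rewrite addnS; have := r2 (n + k)%N; lra.
  - by rewrite divr_gt0.
  - by rewrite addnS; exact: Ax.
by have := dtri (f (n + N)%N x) (f n x) (g x); lra.
Qed.

(** The usual construction: shrinking balls, the ball of rank n.+1 avoiding F n,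
    close on a point by L0_complete. *)
Lemma L0_baire (C : set L0G) g (N : set L0G) : comeager C -> nbhs g N ->
  exists f, N f /\ C f.
Proof.
move=> [F nF CF] /nbhs_L0_close[r0 r00 r0N].
pose S := (nat * (L0G * R))%type.
pose next (s t : S) := [/\ t.1 = s.1.+1, 2 * t.2.2 <= s.2.2,
  L0_close (s.2.2 / 4) s.2.1 t.2.1 &
  forall h, L0_close t.2.2 t.2.1 h -> ~ F s.1 h].
have step (s : {s : S | 0 < s.2.2}) :
    {t : {s : S | 0 < s.2.2} | next (sval s) (sval t)}.
  apply: cid; case: s => -[n [f r]] /= rp.
  have r4 : 0 < r / 4 by rewrite divr_gt0.
  have := L0_close_nbhs f r4; rewrite nbhsE => -[U [oU Uf] Ufr].
  have /nowhere_denseP/(_ U oU (ex_intro _ f Uf)) := nF n.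
  move=> /existsNP[f' /not_implyP[Uf' nclf']].
  have : nbhs f' (~` closure (F n)).
    apply: open_nbhs_nbhs; split=> //.
    by apply: closed_openC; exact: closed_closure.
  move=> /nbhs_L0_close[s s0 sF].
  have rs0 : 0 < Num.min s (r / 2) by rewrite lt_min s0 divr_gt0.
  exists (exist _ (n.+1, (f', Num.min s (r / 2))) rs0); split=> //=.
  - by rewrite mulrC -ler_pdivlMr// ge_min lexx orbT.
  - exact: Ufr.
  - move=> h f'h Fh; apply: (sF h); last exact: subset_closure.
    by apply: L0_close_le f'h; rewrite ge_min lexx.
have [u [u0 un]] := dependent_choice step (exist _ (0%N, (g, r0)) r00).
have uE n : (sval (u n)).1 = n.
  by elim: n => [|n IH]; [rewrite u0|have [-> _ _ _] := un n; rewrite IH].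
have [|n|n|h hP] := @L0_complete
  (fun n => (sval (u n)).2.1) (fun n => (sval (u n)).2.2).
- by move=> n; exact: (svalP (u n)).
- by have [] := un n.
- by have [] := un n.
exists h; split; first by apply: r0N; have := hP 0%N; rewrite u0.
rewrite -[C]setCK CF => -[n _].
by have [_ _ _] := un n; rewrite uE; apply.
Qed.

End L0Metric.

(** * Separability of L0(G) *)

Section Separability.
Context d (T : measurableType d) (R : realType) (mu : probability T R).

(** Separability of the measure algebra of mu. *)
Definition separable_measure := exists2 B : nat -> set T,
  (forall n, measurable (B n)) &
  forall A (e : R), measurable A -> 0 < e ->
    exists n, (mu (A `+` B n) < e%:E)%E.

(** Cut the values of i at a large N and approximate the finitely many level
    sets by sets B m. The list of the indices m codes the approximation: j x is
    the position of the first set of the list that contains x. *)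
Lemma countable_index : separable_measure ->
  exists2 j : nat -> T -> nat, (forall n k, measurable [set x | j n x = k]) &
  forall (i : T -> nat) (e : R), (forall k, measurable [set x | i x = k]) ->
    0 < e -> exists n, mostly mu e [set x | i x = j n x].
Proof.
move=> [B mB BP].
pose J (s : seq nat) x := find (fun m => `[< B m x >]) s.
have mJ s k : measurable [set x | J s x = k].
  elim: s k => [|m s IH] k.
    have [->|k0] := eqVneq k 0%N.
      by rewrite (_ : [set _ | _] = setT)//; apply/seteqP; split.
    rewrite (_ : [set _ | _] = set0)//; apply/seteqP; split=> // x /esym/eqP.
    by rewrite (negPf k0).
  case: k => [|k].
    rewrite (_ : [set _ | _] = B m)//; apply/seteqP; split=> x;
      by rewrite /J /=; case: asboolP.
  rewrite (_ : [set _ | _] = ~` B m `&` [set x | J s x = k]).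
    by apply: measurableI => //; exact: measurableC.
  apply/seteqP; split=> x; rewrite /J /=; case: asboolP => // Bm.
  - by case.
  - by case.
  - by case=> _ <-.
exists (fun n => if unpickle n is Some s then J s else fun=> 0%N).
  move=> n k; case: unpickle => [s|]; first exact: mJ.
  exact: (mJ [::] k).
move=> i e mi e0; have e2 : 0 < e / 2 by rewrite divr_gt0.
have [n|m n mn x /= im|x||N NP] :=
  @mostly_exhaust _ _ _ mu (fun N => [set x | (i x < N)%N]) (e / 2).
- rewrite (_ : [set _ | _] = \bigcup_(k in `I_n) [set x | i x = k]).
    by apply: bigcup_measurable => k _.
  by apply/seteqP; split=> [x /= ix|x [k /= kn ->]] //; exists (i x).
- exact: leq_trans im mn.
- by exists (i x).+1; rewrite /=.
- by [].
(* N level sets, plus one share for the empty conjunction that starts the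
   induction. *)
pose del := e / 2 / N.+1%:R.
have del0 : 0 < del by rewrite divr_gt0.
have /choice[m mP] l : exists m, (mu ([set x | i x = l] `+` B m) < del%:E)%E.
  exact: BP.
have mostly_eq l : mostly mu del [set x | i x = l <-> B (m l) x].
  exists ([set x | i x = l] `+` B (m l)); split=> //.
    by apply: measurableU; exact: measurableD.
  move=> x /not_orP[/not_andP nl /not_andP nr] /=; split=> [il|Bx].
    by case: nl => // /contrapT.
  by case: nr => // /contrapT.
have mostly_all k : mostly mu (k.+1%:R * del)
    [set x | forall l, (l < k)%N -> (i x = l <-> B (m l) x)].
  elim: k => [|k IH].
    by rewrite mul1r; apply: ae_mostly => //; exact: aeW.
  rewrite -(natr1 k.+1) mulrDl mul1r; apply: mostlyS (mostlyI IH (mostly_eq k)).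
  move=> x [xk xk1] l; rewrite ltnS leq_eqVlt => /orP[/eqP->//|]; exact: xk.
exists (pickle (map m (iota 0 N))); rewrite pickleK [e]splitr.
have := mostly_all N; rewrite /del mulrC divfK// => eN.
apply: mostlyS (mostlyI NP eN) => x [/= ixN xN].
rewrite /J find_map (@eq_in_find _ _ (pred1 (i x))).
  rewrite -[X in find (pred1 X)](nth_iota 0 0 ixN) -/(index _ _).
  by rewrite index_uniq ?size_iota ?iota_uniq.
move=> l; rewrite mem_iota /= add0n => /xN il.
by apply/asboolP/eqP => [/il/esym|/esym/il].
Qed.

Context (G : polishGroupType R).

(** The functions k n take the value p m where the n-th index function is m, for
    a dense sequence p. Given h, choose measurably an index i x such that h x
    lies in p (i x) V; for some n, the n-th index function agrees with i off
    a set of measure below e. *)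
Lemma L0_countable_translates (V : set G) (e : R) : separable_measure ->
  open_nbhs 1%g V -> 0 < e ->
  exists k : nat -> L0 mu G,
    forall h : L0 mu G, exists n, L0_ball V e ((k n)^-1 * h)%g.
Proof.
move=> /countable_index[j mj jP] [oV V1] e0.
have [b ob bb] := second_countable_basis_seq (@polish_second_countable R G).
pose p n : G := xget 1%g (b n).
pose Vp n := [set y : G | V ((p n)^-1 * y)%g].
have Vcont (y z : G) : V (y^-1 * z)%g -> nbhs z [set t | V (y^-1 * t)%g] /\
    nbhs y [set t | V (t^-1 * z)%g].
  move=> Vyz; have nV : nbhs (y^-1 * z)%g V by exact: open_nbhs_nbhs.
  split; first exact: nbhs_mulgl.
  have [[A1 A2] /= [n1 n2] A12] := @mulg_continuous G ((y^-1)%g, z) V nV.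
  have n1' : nbhs y [set t | A1 (t^-1)%g] by exact: (@invg_continuous G y).
  apply: filterS n1' => t A1t.
  by apply: (A12 ((t^-1)%g, z)); split=> //=; exact: nbhs_singleton.
have oVp n : open (Vp n) by rewrite openE => y /Vcont[].
have /choice[u uE] n : exists g : L0 mu G, \forall x \ae mu, g x = p n.
  exact: L0_cst.
have /choice[k kE] n : exists g : L0 mu G, \forall x \ae mu, g x = u (j n x) x.
  exact: L0_glue.
exists k => h.
have [|x|i mi iP] := @measurable_index _ _ (fun n => h @^-1` Vp n).
- by move=> n; exact: L0_measurable.
- have : nbhs (h x) [set t | V (t^-1 * h x)%g].
    by apply: (Vcont _ _ _).2; rewrite mulVg.
  move=> /bb[n bn bV]; exists n; apply: bV; rewrite /p.
  by case: xgetP => // /(_ (h x)).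
have [n ijn] := jP i e mi e0; exists n; apply/L0_ballP => //.
apply: mostly_ae ijn; near=> x => /= ix.
rewrite (near (L0_ME (k n)^-1%g h) x)// (near (L0_VE (k n)) x)//.
rewrite (near (kE n) x)// (near (ae_foralln uE) x)// -ix.
exact: iP.
Unshelve. all: by end_near. Qed.

End Separability.

(** * From L0(G) to G *)

Section Transfer.
Context d (T : measurableType d) (R : realType) (mu : probability T R).
Context (G : polishGroupType R).
Context (sep : separable_measure mu).
Context (f : L0 mu G) (cf : comeager (conjugacy_class f)).

(** The class of f is dense, so it meets the open sets of functions with more
    than half of their values in U and in W; two such conjugates of f are
    compared at a common point. *)
Lemma L0_conj_transitive : conj_transitive G.
Proof.
have [dist [md nd cd]] := @polish_completely_metrizable R G.
move=> U W oU [u Uu] oW [w Ww].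
have half0 : 0 < 1 / 2 :> R by rewrite divr_gt0.
have hit (A : set G) y : open A -> A y ->
    exists a : L0 mu G, mostly mu (1 / 2) [set x | A (((f ^ a)%g : L0 mu G) x)].
  move=> oA Ay; have [c cE] := L0_cst mu y.
  have nc : nbhs c [set h | mostly mu (1 / 2) [set x | A (h x)]].
    by apply: (nbhs_mostly_in_cst md nd) => //; apply: filterS cE => x ->.
  have [h [hA [a _ fa]]] := L0_baire md nd cd cf nc.
  by exists a; rewrite fa.
have [a aU] := hit U u oU Uu; have [b bW] := hit W w oW Ww.
have abUW : mostly mu 1 [set x | U (f x ^ a x)%g /\ W (f x ^ b x)%g].
  rewrite [1](_ : _ = 1 / 2 + 1 / 2); last by lra.
  apply: mostly_ae (mostlyI aU bW); near=> x => -[/=].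
  by rewrite (near (L0_JE f a) x)// (near (L0_JE f b) x)// => ? ?; split.
have [x [Ux Wx]] := mostly_ex (lexx 1) abUW.
exists (f x ^ a x)%g, ((a x)^-1 * b x)%g; split=> //.
by rewrite conjgM conjgK.
Unshelve. all: by end_near. Qed.

(** Suppose that every open part of U contains two open sets that V does not
    connect. Countably many pieces { f ^ (k n * t) : t mostly in V0 } make up
    the class of f, so one of them is dense in an open set N of functions with
    values mostly in U. But N contains two functions close to the same g, the
    values of which at x lie in open sets that V does not connect, for most x;
    approximating both from the piece gives a contradiction. *)
Lemma L0_conj_locally_transitive : conj_locally_transitive G.
Proof.
have [dist [md nd cd]] := @polish_completely_metrizable R G.
have [d0 _ dC dtri] := md.
move=> V U nV oU U0; apply: contrapT => nW.
have {nW} nmix W : open W -> W !=set0 -> W `<=` U -> exists O12 : set G * set G,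
    [/\ open O12.1, O12.1 !=set0 & O12.1 `<=` W] /\
    [/\ open O12.2, O12.2 !=set0, O12.2 `<=` W &
        forall y v, O12.1 y -> V v -> ~ O12.2 (y ^ v)%g].
  move=> oW W0 WU; apply: contrapT => nO; apply: nW; exists W; split=> //.
  move=> O1 O2 oO1 O10 O1W oO2 O20 O2W; apply: contrapT => nv; apply: nO.
  exists (O1, O2); split; split=> //= y v O1y Vv O2yv.
  by apply: nv; exists y, v.
have [V0 oV0 V0V] : exists2 V0, open_nbhs (1%g : G) V0 &
    forall v w, V0 v -> V0 w -> V (v^-1 * w)%g.
  have oV : open_nbhs 1%g V° by split=> //; exact: open_interior.
  have [Q oQ QV] := mulg_open_nbhs oV.
  have [Q' [oQ' Q'1] Q'Q] := invg_open_nbhs oQ.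
  exists (Q' `&` Q); first by case: oQ => oQ Q1; split; [exact: openI|split].
  by move=> v w [/Q'Q Qv _] [_ Qw]; exact: interior_subset (QV _ _ Qv Qw).
(* Five exceptional sets of measure below e will have to leave a point. *)
pose e : R := 8^-1; have e0 : 0 < e by rewrite invr_gt0.
have [k kP] := L0_countable_translates sep oV0 e0.
pose inU := [set h : L0 mu G | mostly mu e [set x | U (h x)]].
pose E n := [set (f ^ (k n * t))%g | t in L0_ball V0 e] `&` inU.
have [n nE] : exists n, ~ nowhere_dense (E n).
  apply: contrapT => /forallNP nE.
  have cE : comeager (\bigcap_n ~` E n).
    apply: comeager_bigcap => n; apply: nowhere_dense_comeagerC.
    exact: contrapT (nE n).
  have [u Uu] := U0; have [c cU] := L0_cst mu u.
  have nc : nbhs c inU.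
    by apply: (nbhs_mostly_in_cst md nd) => //; apply: filterS cU => x ->.
  have [h [Uh [[a _ fa] nEh]]] := L0_baire md nd cd (comeagerI cf cE) nc.
  have [n an] := kP a; apply: (nEh n I); split=> //.
  by exists ((k n)^-1 * a)%g => //; rewrite mulgA mulgV mul1g.
have {nE} [N [oN [g0 Og0] OE]] :
    exists N, [/\ open N, N !=set0 & N `<=` closure (E n)].
  apply: contrapT => nO; apply: nE; apply/nowhere_denseP => N oN N0 OE.
  by apply: nO; exists N.
have [g [gU Og]] : exists g : L0 mu G, inU g /\ N g.
  have [g [[_ gU] Og]] := OE _ Og0 _ (open_nbhs_nbhs (conj oN Og0)).
  by exists g.
have [r r0 rO] := nbhs_L0_close md nd (open_nbhs_nbhs (conj oN Og)).
have [b ob bb] := second_countable_basis_seq (@polish_second_countable R G).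
(* Index 0 stands for the points that g sends outside U; index m.+1 for a basic
   b m around g x, inside U and so small that moving g within it stays in N. *)
pose good m := b m `<=` U /\ forall y z, b m y -> b m z -> dist y z < r.
pose A m := if m is m'.+1 then [set x | good m' /\ b m' (g x)]
            else [set x | ~ U (g x)].
have [m|x|i mi iA] := @measurable_index _ _ A.
- case: m => [|m] /=; first by apply: measurableC; exact: L0_measurable.
  have [gm|ngm] := pselect (good m).
    rewrite (_ : [set _ | _] = g @^-1` b m); first exact: L0_measurable.
    by apply/seteqP; split=> x //= [].
  by rewrite (_ : [set _ | _] = set0)//; apply/seteqP; split=> x //= [].
- have [Ux|nUx] := pselect (U (g x)); last by exists 0%N.
  have r2 : 0 < r / 2 by rewrite divr_gt0.
  have : nbhs (g x) (U `&` [set y | dist (g x) y < r / 2]).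
    by apply: filterI; [exact: open_nbhs_nbhs|exact: (nbhs_metric nd)].
  move=> /bb[m bm bU]; exists m.+1; split=> //; split=> [y /bU[]//|y z].
  move=> /bU[_ /= gy] /bU[_ /= gz].
  by have := dtri (g x) y z; rewrite (dC y (g x)); lra.
(* For each index m: the two open sets that V does not connect, and constant
   functions with values in them; at index 0, no constraint and g itself;
   empty sets when b is not good or empty there, as then no x has that index. *)
pose spec m (p : (set G * set G) * (L0 mu G * L0 mu G)) :=
  [/\ open p.1.1, open p.1.2,
      \forall x \ae mu, i x = m -> p.1.1 (p.2.1 x) /\ dist (g x) (p.2.1 x) < r,
      \forall x \ae mu, i x = m -> p.1.2 (p.2.2 x) /\ dist (g x) (p.2.2 x) < r &
      (0 < m)%N -> forall y v, p.1.1 y -> V v -> ~ p.1.2 (y ^ v)%g].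
have /choice[p pP] m : exists p, spec m p.
  case: m => [|m].
    exists ((setT, setT), (g, g)); split=> //=; try exact: openT.
      by apply: aeW => x _; rewrite d0.
    by apply: aeW => x _; rewrite d0.
  have [[[bU br] bm0]|nb] := pselect (good m /\ b m !=set0); last first.
    have im x : i x <> m.+1.
      move=> ix; have := iA x; rewrite ix => -[gm bgx]; apply: nb.
      by split=> //; exists (g x).
    exists ((set0, set0), (g, g)); split=> //=; try exact: open0.
      by apply: aeW => x /im.
    by apply: aeW => x /im.
  have [[P1 P2] [/= [oO1 [y1 Oy1] O1b] [oO2 [y2 Oy2] O2b mix]]] :=
    nmix _ (ob m) bm0 bU.
  have [c1 cE1] := L0_cst mu y1; have [c2 cE2] := L0_cst mu y2.
  exists ((P1, P2), (c1, c2)); split=> //=.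
    apply: filterS cE1 => x -> ix; split=> //; apply: br; last exact: O1b.
    by have := iA x; rewrite ix => -[].
  apply: filterS cE2 => x -> ix; split=> //; apply: br; last exact: O2b.
  by have := iA x; rewrite ix => -[].
(* Gluing the constants gives an element of N, and the piece of the class that
   is dense in N comes close enough to it. *)
have meets (W : nat -> set G) (u : nat -> L0 mu G) : (forall m, open (W m)) ->
    (forall m, \forall x \ae mu,
       i x = m -> W m (u m x) /\ dist (g x) (u m x) < r) ->
    exists2 t, L0_ball V0 e t &
      mostly mu e [set x | W (i x) (((f ^ (k n * t))%g : L0 mu G) x)].
  move=> oW Wu; have [h hE] := L0_glue u mi.
  have hW : \forall x \ae mu, W (i x) (h x) /\ dist (g x) (h x) < r.
    have := ae_foralln Wu; apply: filterS2 hE => x -> ; exact.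
  have Oh : N h.
    apply: rO; apply: ae_mostly => //; apply: filterS hW => x [] //.
  have nh := @nbhs_mostly_in _ _ _ mu G dist md nd i W h e mi oW _ e0.
  have [|_ [[[t Vt <-] _] tW]] := OE _ Oh _ (nh _).
    by apply: filterS hW => x [].
  by exists t.
have [t1 Vt1 W1] := meets (fun m => (p m).1.1) (fun m => (p m).2.1)
  (fun m => let: And5 o _ _ _ _ := pP m in o)
  (fun m => let: And5 _ _ o _ _ := pP m in o).
have [t2 Vt2 W2] := meets (fun m => (p m).1.2) (fun m => (p m).2.2)
  (fun m => let: And5 _ o _ _ _ := pP m in o)
  (fun m => let: And5 _ _ _ o _ := pP m in o).
move: Vt1 Vt2 => /L0_ballP Vt1 /L0_ballP Vt2.
have {}Vt1 := Vt1 oV0.1; have {}Vt2 := Vt2 oV0.1.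
have e5 : e + e + (e + e) + e <= 1 by rewrite /e; lra.
(* Both conjugates come from this single one, by conjugators t1 and t2. *)
pose fk : L0 mu G := (f ^ k n)%g.
have all5 : mostly mu (e + e + (e + e) + e) [set x |
    [/\ V0 (t1 x), V0 (t2 x), (p (i x)).1.1 (fk x ^ t1 x)%g,
        (p (i x)).1.2 (fk x ^ t2 x)%g & U (g x)]].
  apply: mostly_ae (mostlyI (mostlyI (mostlyI Vt1 Vt2) (mostlyI W1 W2)) gU).
  near=> x => -[[[/= V1 V2]]] [].
  by rewrite !conjgM -/fk (near (L0_JE fk t1) x)// (near (L0_JE fk t2) x)//.
have [x [V1 V2 O1 O2 Ux]] := mostly_ex e5 all5.
have ix : (0 < i x)%N.
  by rewrite lt0n; apply/eqP => ix; have := iA x; rewrite ix.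
have [_ _ _ _ mx] := pP (i x).
apply: (mx ix _ _ O1 (V0V _ _ V1 V2)).
by rewrite conjgM conjgK.
Unshelve. all: by end_near. Qed.

Theorem L0_comeager_class_transfer : has_comeager_conjugacy_class G.
Proof.
apply: comeager_conjugacy_class_criterion; first exact: L0_conj_transitive.
exact: L0_conj_locally_transitive.
Qed.

End Transfer.

(** * The measure algebra of the unit interval *)

Import numFieldNormedType.Exports.

Section RationalApproximation.
Context (R : realType).

Definition rat_union (s : seq (rat * rat)) : set R :=
  \bigcup_(q in [set` s]) `]ratr q.1, ratr q.2[%classic.

Lemma measurable_rat_union s : measurable (rat_union s).
Proof.
apply: fin_bigcup_measurable => [|q _]; first exact: finite_seq.
exact: measurable_itv.
Qed.

(** By regularity X lies between a compact K and an open U that are close in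
    measure; finitely many rational intervals inside U cover K, and their union
    is caught between the two as well. *)
Lemma lebesgue_rat_union_approx (X : set R) (e : R) :
  measurable X -> (lebesgue_measure X < +oo)%E -> 0 < e ->
  exists s, (lebesgue_measure (X `\` rat_union s) < e%:E)%E /\
            (lebesgue_measure (rat_union s `\` X) < e%:E)%E.
Proof.
move=> mX fX e0.
have [K [cK KX Ke]] := lebesgue_regularity_inner mX fX e0.
have [U [oU XU Ue]] := lebesgue_regularity_outer mX fX e0.
pose I (q : rat * rat) : set R := `]ratr q.1, ratr q.2[%classic.
have mK : measurable K.
  exact: compact_measurable.
have mU : measurable U by exact: open_measurable.
have := cK; rewrite compact_cover => /(_ _ [set q | I q `<=` U] I).
case=> [q _|x Kx|s sU Ks]; first exact: itv_open.
  have : nbhs x U by apply: open_nbhs_nbhs; split => //; exact/XU/KX.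
  move=> [r /= r0 rU].
  have [q1 q1x] := @rat_in_itvoo R (x - r) x ltac:(lra).
  have [q2 q2x] := @rat_in_itvoo R x (x + r) ltac:(lra).
  move: q1x q2x; rewrite !in_itv /= => /andP[q1r q1x] /andP[xq2 q2r].
  exists (q1, q2); last by rewrite /I /= in_itv /= q1x xq2.
  move=> y; rewrite /I /= in_itv /= => /andP[q1y yq2]; apply: rU => /=.
  by rewrite ltr_norml; apply/andP; split; lra.
pose t : seq (rat * rat) := finmap.enum_fset s.
have KI : K `<=` rat_union t by move=> x /Ks[q qs xq]; exists q.
have IU : rat_union t `<=` U.
  by move=> x [q /= qs xq]; have := sU q qs; rewrite inE => /(_ x xq).
exists t; split.
  apply: le_lt_trans Ke; apply: le_measure; rewrite ?inE.
  - by apply: measurableD => //; exact: measurable_rat_union.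
  - exact: measurableD.
  - by apply: setDS.
apply: le_lt_trans Ue; apply: le_measure; rewrite ?inE.
- by apply: measurableD => //; exact: measurable_rat_union.
- exact: measurableD.
- by apply: setSD.
Qed.

End RationalApproximation.

Section Interval.
Context (R : realType).
Local Notation I := (unit_interval R).
Local Notation v := (@unit_interval_val R).
Local Notation cleb := (@completed_lebesgue_measure R).

(** A Lebesgue measurable set is a Borel set up to a null set, and Borel sets
    are approximated by the countably many finite unions of rational
    intervals. *)
Lemma lebesgue01_separable : separable_measure (lebesgue01 R).
Proof.
pose S s := v @^-1` rat_union s.
have range_v : range v = `[0, 1]%classic.
  apply/seteqP; split=> [_ [x _ <-]|x x01].
    by rewrite /v set_valE; case: x => /= x /set_mem.
  by exists (exist _ x (mem_set x01)).
have vS s : v @` S s = `[0, 1]%classic `&` rat_union s.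
  rewrite -range_v; apply/seteqP; split=> [_ [x Sx <-]|_ [[x _ <-] Sx]].
    by split=> //; exists x.
  by exists x.
have mS s : measurable (S s).
  rewrite /measurable /= /unit_interval_measurable vS.
  apply: measurableI; apply: sub_caratheodory; first exact: measurable_itv.
  exact: measurable_rat_union.
exists (fun n => if unpickle n is Some s then S s else set0).
  by move=> n; case: unpickle => [s|] //; exact: mS.
move=> A e mA e0.
have : measurable (v @` A) by [].
rewrite -[X in X _]completed_caratheodory_measurable.
rewrite g_sigma_completed_algebra_genE.
move=> [X mX [N [M [mM M0 NM]] XN]].
have e2 : 0 < e / 2 by rewrite divr_gt0.
have vinj : injective v by exact: val_inj.
have [|s [s1 s2]] := lebesgue_rat_union_approx mX _ e2.
  apply: (@le_lt_trans _ _ (lebesgue_measure (`[0, 1]%classic : set R))).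
    apply: le_measure; rewrite ?inE//.
    move=> x Xx; have : (v @` A) x by rewrite -XN; left.
    by case=> y _ <-; rewrite -range_v; exists y.
  by rewrite lebesgue_measure_itv /= lte01 oppr0 adde0 ltry.
exists (pickle s); rewrite pickleK.
have subc := @sub_caratheodory _ _ _ (wlength (R := R) idfun).
have mrs : measurable (rat_union s : set R) by exact: measurable_rat_union.
have mXS : measurable ((X `\` rat_union s) : set R) by exact: measurableD.
have mSX : measurable ((rat_union s `\` X) : set R) by exact: measurableD.
have vAS : v @` (A `+` S s) `<=`
    ((X `\` rat_union s) `|` (rat_union s `\` X)) `|` M.
  move=> _ [x [[Ax nSx]|[Sx nAx]] <-].
    have : (v @` A) (v x) by exists x.
    by rewrite -XN => -[Xx|/NM]; [left; left|right].
  left; right; split=> // Xx; have : (v @` A) (v x) by rewrite -XN; left.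
  by case=> y Ay /vinj xy; apply: nAx; rewrite -xy.
apply: (@le_lt_trans _ _
  (cleb (((X `\` rat_union s) `|` (rat_union s `\` X)) `|` M))).
  apply: le_measure; rewrite ?inE//.
    apply: (_ : measurable (A `+` S s)).
    by apply: measurableU; exact: measurableD.
  by apply: measurableU; [apply: measurableU|]; exact: subc.
apply: le_lt_trans.
  apply: measureU2; last by exact: subc.
  by apply: measurableU; exact: subc.
rewrite [X in (_ + X)%E](_ : _ = 0%E) ?adde0; last exact: M0.
apply: le_lt_trans; first by apply: measureU2; exact: subc.
by rewrite [e]splitr EFinD lteD.
Qed.

End Interval.

Theorem corollary3p2 (R : realType) (G : polishGroupType R) :
  has_comeager_conjugacy_class (L0 (lebesgue01 R) G) ->
  has_comeager_conjugacy_class G.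
Proof.
move=> [f cf]; apply: L0_comeager_class_transfer cf.
exact: lebesgue01_separable.
Qed.
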